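(* Fix a sign and let $\alpha=\pm\frac{i}{3}$ (upper signs throughout for $\alpha=\frac i3$, lower signs for $\alpha=-\frac i3$). On a space with coordinates $(x,y,z,p,q)$ let $$E^1=\tfrac i2(y^2-1)\partial_y-\tfrac i2(2yp+1)\partial_p-iy\,\partial_z,\quad E^2=\tfrac12(y^2+1)\partial_y-\tfrac12(2yp+1)\partial_p-y\,\partial_z,\quad E^3=i(y\partial_y-p\partial_p-\partial_z),$$ and consider the rolling distribution spanned by $$X^1=\partial_x-E^2,\qquad X^{2\pm}=i\partial_q-e^{\alpha x}E^1+\alpha e^{\alpha x}E^3 .$$ Then the Lie algebra of split $\mathfrak g_2$ is obtained from the pairwise bracket-generating set $\{S^1,S^2,S^3\}$, i.e. the following three vector fields pairwise bracket-generate the Lie algebra of split $\mathfrak g_2$: $$\begin{aligned} S^1&=\pm\tfrac{3i}{4}e^{-\frac z2\pm\frac{ix}{6}}\big((y\pm i)p+1\big)X^1\mp\tfrac32 e^{-\frac z2\mp\frac{ix}{6}}\big((y\mp i)p+1\big)X^{2\pm},\\ S^2&=\mp\tfrac{3i}{4}e^{\frac z2\pm\frac{ix}{6}}(y\pm i)X^1\pm\tfrac32 e^{\frac z2\mp\frac{ix}{6}}(y\mp i)X^{2\pm},\\ S^3&=\mp 4iq\,X^1+\tfrac23 i\big(q^2-9e^{\mp\frac{2ix}{3}}\big)X^{2\pm}\mp\tfrac29 q^2e^{\pm\frac{ix}{3}}\big(5E^3\pm 3iE^1\big). \end{aligned}$$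
   Context: Here $i^2=-1$; vector fields have complex-valued analytic coefficients in $(x,y,z,p,q)$, and brackets are the usual Lie brackets extended complex-bilinearly. The distribution spanned by $X^1,X^{2\pm}$ is the common annihilator of $\omega_1=\sigma_1-ie^{\alpha x}dq$, $\omega_2=\sigma_2+dx$, $\omega_3=\sigma_3+i\alpha e^{\alpha x}dq$, where $\sigma_1=i(dy+y\,dz)-i(y^2-1)(dp-p\,dz)$, $\sigma_2=dy+y\,dz-(y^2+1)(dp-p\,dz)$, $\sigma_3=-2iy(dp-p\,dz)+i\,dz$, and $E^1,E^2,E^3$ are dual to $\sigma_1,\sigma_2,\sigma_3$. Definition (pairwise bracket-generation). Given vector fields $S^1,S^2,S^3$, set $$S^4=[S^1,S^2],\quad S^5=[S^2,S^3],\quad S^6=[S^3,S^1],$$ $$L^1=[S^1,S^4],\quad L^2=[S^2,S^4],\quad L^3=[S^2,S^5],\quad L^4=[S^3,S^5],\quad L^5=[S^3,S^6],\quad L^6=[S^1,S^6],$$ $$H=[S^2,S^6],\qquad h=[S^4,S^3].$$ One says that $\{S^1,S^2,S^3\}$ pairwise bracket-generate the Lie algebra of split $\mathfrak g_2$ if the 14 vector fields $$S^1,\dots,S^6,\ \tfrac14(h-H),\ \tfrac{\sqrt3}{12}(h+H),\ L^1,\dots,L^6$$ form (a basis, over $\mathbb R$, of) the 14-dimensional Lie algebra of split $\mathfrak g_2$ (the split real form), with Cartan subalgebra spanned by $A=\frac14(h-H)$ and $B=\frac{\sqrt3}{12}(h+H)$, and with root diagram, with respect to this Cartan subalgebra,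 as follows (a vector field $V$ is a root vector with root $(a,b)$ if $[A,V]=aV$ and $[B,V]=bV$): short roots $S^1:(1,0)$, $S^5:(-1,0)$, $S^4:(\frac12,\frac{\sqrt3}2)$, $S^3:(-\frac12,-\frac{\sqrt3}2)$, $S^2:(-\frac12,\frac{\sqrt3}2)$, $S^6:(\frac12,-\frac{\sqrt3}2)$; long roots $L^1:(\frac32,\frac{\sqrt3}2)$, $L^4:(-\frac32,-\frac{\sqrt3}2)$, $L^2:(0,\sqrt3)$, $L^5:(0,-\sqrt3)$, $L^3:(-\frac32,\frac{\sqrt3}2)$, $L^6:(\frac32,-\frac{\sqrt3}2)$. *)

(* Defs.v *)
From Stdlib Require Export Reals List FunctionalExtensionality.
From Coquelicot Require Export Coquelicot.
Export ListNotations.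

Open Scope R_scope.

Section FctModule.

Context {T : Type} {K : Ring} (V : ModuleSpace K).

Definition fct_AbelianMonoid_mixin : AbelianMonoid.mixin_of (T -> V).
Proof.
refine (AbelianMonoid.Mixin (T -> V) (fun f g t => plus (f t) (g t)) (fun _ => zero) _ _ _);
  intros; apply functional_extensionality; intro t.
- apply plus_comm.
- apply plus_assoc.
- apply plus_zero_r.
Defined.

Definition fct_AbelianMonoid : AbelianMonoid :=
  AbelianMonoid.Pack (T -> V) fct_AbelianMonoid_mixin (T -> V).

Definition fct_AbelianGroup_mixin : AbelianGroup.mixin_of fct_AbelianMonoid.
Proof.
refine (AbelianGroup.Mixin fct_AbelianMonoid (fun f t => opp (f t)) _).
intros; apply functional_extensionality; intro t; apply (plus_opp_r (x t)).
Defined.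

Definition fct_AbelianGroup_class : AbelianGroup.class_of (T -> V) :=
  AbelianGroup.Class (T -> V) fct_AbelianMonoid_mixin fct_AbelianGroup_mixin.

Definition fct_AbelianGroup : AbelianGroup :=
  AbelianGroup.Pack (T -> V) fct_AbelianGroup_class (T -> V).

Definition fct_ModuleSpace_mixin : ModuleSpace.mixin_of K fct_AbelianGroup.
Proof.
refine (ModuleSpace.Mixin K fct_AbelianGroup (fun a f t => scal a (f t)) _ _ _ _);
  intros; apply functional_extensionality; intro t.
- apply scal_assoc.
- apply scal_one.
- apply (scal_distr_l x (u t) (v t)).
- apply (scal_distr_r x y (u t)).
Defined.

Definition fct_ModuleSpace : ModuleSpace K :=
  ModuleSpace.Pack K (T -> V)
    (ModuleSpace.Class K (T -> V) fct_AbelianGroup_class fct_ModuleSpace_mixin)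
    (T -> V).

End FctModule.

Arguments fct_ModuleSpace T {K} V.

Section RealLie.

Context {V : ModuleSpace R_Ring}.
Implicit Types (br : V -> V -> V) (g h P : V -> Prop).

Inductive span P : V -> Prop :=
| span_zero : span P zero
| span_cons a u v : P u -> span P v -> span P (plus (scal a u) v).

Fixpoint lincomb (c : list R) (l : list V) : V :=
  match c, l with
  | a :: c', v :: l' => plus (scal a v) (lincomb c' l')
  | _, _ => zero
  end.

Definition lin_indep (l : list V) : Prop :=
  forall c, length c = length l -> lincomb c l = zero -> List.Forall (fun a => a = 0) c.

Definition subalgebra br g : Prop :=
  g zero
  /\ (forall u v, g u -> g v -> g (plus u v))
  /\ (forall a u, g u -> g (scal a u))
  /\ (forall u v, g u -> g v -> g (br u v)).

Fixpoint lower_central br h (n : nat) : V -> Prop :=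
  match n with
  | O => h
  | S n' => span (fun w => exists u v, h u /\ lower_central br h n' v /\ w = br u v)
  end.

Definition nilpotent br h : Prop :=
  exists n, forall v, lower_central br h n v -> v = zero.

Definition cartan_subalgebra br g h : Prop :=
  (forall u, h u -> g u)
  /\ subalgebra br h
  /\ nilpotent br h
  /\ (forall u, g u -> (forall v, h v -> h (br u v)) -> h u).

End RealLie.

Definition lie_isomorphic {U V : ModuleSpace R_Ring}
    (brU : U -> U -> U) (g : U -> Prop) (brV : V -> V -> V) (g' : V -> Prop) : Prop :=
  exists phi : U -> V,
    (forall u, g u -> g' (phi u))
    /\ (forall u v, g u -> g v -> phi (plus u v) = plus (phi u) (phi v))
    /\ (forall a u, g u -> phi (scal a u) = scal a (phi u))
    /\ (forall u v, g u -> g v -> phi (brU u v) = brV (phi u) (phi v))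
    /\ (forall u v, g u -> g v -> phi u = phi v -> u = v)
    /\ (forall w, g' w -> exists u, g u /\ phi u = w).

Definition V3 : ModuleSpace R_Ring :=
  prod_ModuleSpace R_Ring (prod_ModuleSpace R_Ring R_ModuleSpace R_ModuleSpace) R_ModuleSpace.

Definition dot (u v : V3) : R :=
  let '(u1, u2, u3) := u in
  let '(v1, v2, v3) := v in
  u1 * v1 + u2 * v2 + u3 * v3.

Definition cross (u v : V3) : V3 :=
  let '(u1, u2, u3) := u in
  let '(v1, v2, v3) := v in
  (u2 * v3 - u3 * v2, u3 * v1 - u1 * v3, u1 * v2 - u2 * v1).

(** [(a, v, w, b)] stands for the vector matrix with rows [a v] and [w b]; its
    norm is [a * b - dot v w]. *)
Definition octonion : ModuleSpace R_Ring :=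
  prod_ModuleSpace R_Ring
    (prod_ModuleSpace R_Ring (prod_ModuleSpace R_Ring R_ModuleSpace V3) V3) R_ModuleSpace.

Definition omul (s t : octonion) : octonion :=
  let '(a, v, w, b) := s in
  let '(a', v', w', b') := t in
  (a * a' + dot v w',
   plus (plus (scal a v') (scal b' v)) (cross w w'),
   minus (plus (scal a' w) (scal b w')) (cross v v'),
   b * b' + dot w v').

Definition oct_end : ModuleSpace R_Ring := fct_ModuleSpace octonion octonion.

Definition commutator (D D' : oct_end) : oct_end :=
  fun s => minus (D (D' s)) (D' (D s)).

(** The split real form of [g2]: the derivations of the split octonions. *)
Definition split_g2 (D : oct_end) : Prop :=
  (forall s t, D (plus s t) = plus (D s) (D t))
  /\ (forall (a : R) s, D (scal a s) = scal a (D s))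
  /\ (forall s t, D (omul s t) = plus (omul (D s) t) (omul s (D t))).

Inductive coord : Set := cx | cy | cz | cp | cq.

Definition coord_eq_dec (j k : coord) : {j = k} + {j <> k}.
Proof. decide equality. Defined.

Definition point : Type := coord -> R.

Definition upd (m : point) (j : coord) (t : R) : point :=
  fun k => if coord_eq_dec k j then t else m k.

(** Totalized through [Derive]; this is the usual partial derivative wherever
    [f] is differentiable, in particular for analytic [f]. *)
Definition partial (j : coord) (f : point -> C) (m : point) : C :=
  (Derive (fun t => Re (f (upd m j t))) (m j),
   Derive (fun t => Im (f (upd m j t))) (m j)).

Definition tangent : ModuleSpace R_Ring := fct_ModuleSpace coord C_R_ModuleSpace.

(** [V m k] is the coefficient at [m] of the [k]-th coordinate derivation. *)
Definition vfield : ModuleSpace R_Ring := fct_ModuleSpace point tangent.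

Definition sum_coord (f : coord -> C) : C :=
  (f cx + f cy + f cz + f cp + f cq)%C.

Definition lie_bracket (V W : vfield) : vfield :=
  fun m k => sum_coord (fun j =>
    V m j * partial j (fun m' => W m' k) m - W m j * partial j (fun m' => V m' k) m)%C.

Definition root_vector (A B V : vfield) (a b : R) : Prop :=
  lie_bracket A V = scal a V /\ lie_bracket B V = scal b V.

Definition pairwise_bracket_generate_split_g2 (S1 S2 S3 : vfield) : Prop :=
  let S4 := lie_bracket S1 S2 in
  let S5 := lie_bracket S2 S3 in
  let S6 := lie_bracket S3 S1 in
  let L1 := lie_bracket S1 S4 in
  let L2 := lie_bracket S2 S4 in
  let L3 := lie_bracket S2 S5 in
  let L4 := lie_bracket S3 S5 in
  let L5 := lie_bracket S3 S6 in
  let L6 := lie_bracket S1 S6 in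
  let H := lie_bracket S2 S6 in
  let h := lie_bracket S4 S3 in
  let A : vfield := scal (1 / 4) (minus h H) in
  let B : vfield := scal (sqrt 3 / 12) (plus h H) in
  let basis := [S1; S2; S3; S4; S5; S6; A; B; L1; L2; L3; L4; L5; L6] in
  let g := span (fun V => In V basis) in
  lin_indep basis
  /\ subalgebra lie_bracket g
  /\ lie_isomorphic lie_bracket g commutator split_g2
  /\ cartan_subalgebra lie_bracket g (span (fun V => In V [A; B]))
  /\ root_vector A B S1 1 0
  /\ root_vector A B S5 (-1) 0
  /\ root_vector A B S4 (1 / 2) (sqrt 3 / 2)
  /\ root_vector A B S3 (- (1 / 2)) (- (sqrt 3 / 2))
  /\ root_vector A B S2 (- (1 / 2)) (sqrt 3 / 2)
  /\ root_vector A B S6 (1 / 2) (- (sqrt 3 / 2))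
  /\ root_vector A B L1 (3 / 2) (sqrt 3 / 2)
  /\ root_vector A B L4 (- (3 / 2)) (- (sqrt 3 / 2))
  /\ root_vector A B L2 0 (sqrt 3)
  /\ root_vector A B L5 0 (- sqrt 3)
  /\ root_vector A B L3 (- (3 / 2)) (sqrt 3 / 2)
  /\ root_vector A B L6 (3 / 2) (- (sqrt 3 / 2)).

Definition cexp (c : C) : C :=
  (exp (Re c) * cos (Im c), exp (Re c) * sin (Im c)).

Definition tadd (v w : coord -> C) : coord -> C := fun k => (v k + w k)%C.
Definition tscal (c : C) (v : coord -> C) : coord -> C := fun k => (c * v k)%C.
Definition ddx (j : coord) : coord -> C :=
  fun k => if coord_eq_dec k j then RtoC 1 else RtoC 0.

Declare Scope tangent_scope.
Delimit Scope tangent_scope with T.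
Infix "+" := tadd : tangent_scope.
Notation "c *: v" := (tscal c%C v%T)
  (at level 40, v at level 39, no associativity) : tangent_scope.

Section Rolling.

(** [eps] is the fixed sign: "+-" reads [eps] and "-+" reads [- eps]. *)
Variable eps : R.

Local Notation i := Ci.

Definition alpha : C := (eps * (i / 3))%C.

Definition E1 : vfield := fun m =>
  let y := RtoC (m cy) in let p := RtoC (m cp) in
  ((i / 2 * (y ^ 2 - 1)) *: ddx cy + (- (i / 2) * (2 * y * p + 1)) *: ddx cp
   + (- i * y) *: ddx cz)%T.

Definition E2 : vfield := fun m =>
  let y := RtoC (m cy) in let p := RtoC (m cp) in
  ((1 / 2 * (y ^ 2 + 1)) *: ddx cy + (- (1 / 2) * (2 * y * p + 1)) *: ddx cp
   + (- y) *: ddx cz)%T.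

Definition E3 : vfield := fun m =>
  let y := RtoC (m cy) in let p := RtoC (m cp) in
  (i *: (y *: ddx cy + (- p) *: ddx cp + (- (1)) *: ddx cz))%T.

Definition X1 : vfield := fun m => (ddx cx + (- (1)) *: E2 m)%T.

Definition X2 : vfield := fun m =>
  let x := RtoC (m cx) in
  (i *: ddx cq + (- cexp (alpha * x)) *: E1 m + (alpha * cexp (alpha * x)) *: E3 m)%T.

Definition S1 : vfield := fun m =>
  let x := RtoC (m cx) in let y := RtoC (m cy) in
  let z := RtoC (m cz) in let p := RtoC (m cp) in
  ((eps * (3 * i / 4) * cexp (- (z / 2) + eps * (i * x / 6)) * ((y + eps * i) * p + 1)) *: X1 m
   + (- eps * (3 / 2) * cexp (- (z / 2) - eps * (i * x / 6)) * ((y - eps * i) * p + 1)) *: X2 m)%T.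

Definition S2 : vfield := fun m =>
  let x := RtoC (m cx) in let y := RtoC (m cy) in let z := RtoC (m cz) in
  ((- eps * (3 * i / 4) * cexp (z / 2 + eps * (i * x / 6)) * (y + eps * i)) *: X1 m
   + (eps * (3 / 2) * cexp (z / 2 - eps * (i * x / 6)) * (y - eps * i)) *: X2 m)%T.

Definition S3 : vfield := fun m =>
  let x := RtoC (m cx) in let q := RtoC (m cq) in
  ((- eps * (4 * i * q)) *: X1 m
   + (2 / 3 * i * (q ^ 2 - 9 * cexp (- eps * (2 * i * x / 3)))) *: X2 m
   + (- eps * (2 / 9 * q ^ 2) * cexp (eps * (i * x / 3)))
       *: ((5) *: E3 m + (eps * (3 * i)) *: E1 m))%T.

End Rolling.

(* Main.v *)
Require Import Defs.
From Stdlib Require Import ClassicalEpsilon PropExtensionality Lra Lia.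
From Stdlib Require Import QArith Qreals ZArith.

Open Scope R_scope.

(** The sign disappears after the substitution [j = eps * i]: since [eps ^ 2 = 1],
    also [j ^ 2 = -1], and [X1], [eps * X2] and the three fields [S1], [S2], [S3]
    have coefficients in the ring generated over the Gaussian rationals [Q[j]] by
    [y], [p], [q] and integer powers of [exp (j * x / 6)] and [exp (z / 2)]. This
    ring is stable under the five partial derivatives, so every bracket that
    occurs is an exact computation in it ([lie_bracket_feval]), and one computation
    covers both signs.

    Replacing the Cartan elements by [h = [S4, S3]] and [H = [S2, S6]] makes all
    structure constants of the fourteen fields integers ([structure_constants]).
    On the other side, the derivations of the split octonions are [sl3 + V + V*]
    ([der], [split_g2_span]): a traceless matrix [M] and two vectors [x], [y]. The
    fields [S1], [S2], [S3] correspond to the three coordinate vectors [x]; taking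
    the same iterated brackets there gives a basis of [split_g2] with the same
    integers as structure constants ([commutator_oct_basis]).

    Both families are linearly independent: for the fields, evaluation at four
    points with [x = z = 0] already separates them ([rolling_basis_indep]). Two
    bases with equal structure constants span isomorphic Lie algebras; the
    isomorphism is built as its graph, the span of the pairs of corresponding
    basis vectors, which is a subalgebra of the product
    ([lie_isomorphic_of_graph]). The roots are read off from the brackets with [h]
    and [H], and nonzero roots force the span of the two Cartan elements to be
    self-normalizing ([cartan_of_weights]). *)

(** * Spans and coordinates *)

Section Spans.

Context {V : ModuleSpace R_Ring}.
Implicit Types (P K : V -> Prop) (br : V -> V -> V) (l : list V) (c d : list R).

Lemma scal_0 (v : V) : scal 0 v = zero.
Proof. exact (scal_zero_l v). Qed.

Lemma scal_1 (v : V) : scal 1 v = v.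
Proof. exact (scal_one v). Qed.

Lemma opp_lin a (u v : V) : opp (plus (scal a u) v) = plus (scal a (opp u)) (opp v).
Proof.
etransitivity; [apply (opp_plus (scal a u) v)|].
f_equal. symmetry. exact (scal_opp_r a u).
Qed.

Lemma span_single P v : P v -> span P v.
Proof.
intros Hv. rewrite <- (plus_zero_r v), <- (scal_1 v).
now apply span_cons; [|apply span_zero].
Qed.

Lemma span_plus P u v : span P u -> span P v -> span P (plus u v).
Proof.
intros Hu Hv; induction Hu as [|a w u' Hw Hu' IH].
- now rewrite plus_zero_l.
- rewrite <- plus_assoc. now apply span_cons.
Qed.

Lemma span_scal P a u : span P u -> span P (scal a u).
Proof.
intros Hu; induction Hu as [|b w u' Hw Hu' IH].
- rewrite scal_zero_r. apply span_zero.
- rewrite scal_distr_l, scal_assoc. now apply span_cons.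
Qed.

Lemma span_opp P u : span P u -> span P (opp u).
Proof. intros Hu. rewrite <- scal_opp_one. now apply span_scal. Qed.

Lemma span_least P K :
  K zero -> (forall a u v, K u -> K v -> K (plus (scal a u) v)) ->
  (forall v, P v -> K v) -> forall v, span P v -> K v.
Proof. intros K0 Kc HP v Hv; induction Hv; auto. Qed.

Lemma span_span P K u : (forall v, P v -> span K v) -> span P u -> span K u.
Proof.
intros HP. revert u. apply span_least; auto using span_zero.
intros; now apply span_plus; [apply span_scal|].
Qed.

Definition supported P c l : Prop :=
  length c = length l /\ forall a u, In (a, u) (combine c l) -> a = 0 \/ P u.

Lemma span_lincomb P c l : supported P c l -> span P (lincomb c l).
Proof.
revert c; induction l as [|v l IH]; intros [|a c] [Hlen Hs]; simpl in *;
  try apply span_zero; try discriminate.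
assert (Hl : span P (lincomb c l)).
{ apply IH; split; [now injection Hlen|]. intros; apply Hs; auto. }
destruct (Hs a v) as [Ha|Hv]; [auto| |].
- subst a. rewrite scal_0, plus_zero_l. exact Hl.
- now apply span_cons.
Qed.

Definition add_coefs c d : list R := map (fun p => fst p + snd p) (combine c d).

Lemma lincomb_add c d l :
  length c = length l -> length d = length l ->
  lincomb (add_coefs c d) l = plus (lincomb c l) (lincomb d l).
Proof.
revert c d; induction l as [|v l IH]; intros [|a c] [|b d]; simpl; intros Hc Hd;
  try discriminate; [now rewrite plus_zero_l|].
injection Hc as Hc; injection Hd as Hd.
unfold add_coefs in IH; rewrite (IH c d Hc Hd).
change (scal (a + b) v) with (scal (@plus R_Ring a b) v).
rewrite (scal_distr_r a b v), <- !plus_assoc. f_equal.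
rewrite !plus_assoc. f_equal. apply plus_comm.
Qed.

Lemma lincomb_scal a c l :
  lincomb (map (Rmult a) c) l = scal a (lincomb c l).
Proof.
revert l; induction c as [|b c IH]; intros [|v l]; simpl;
  try now rewrite scal_zero_r.
now rewrite IH, scal_distr_l, scal_assoc.
Qed.

Lemma lincomb_zero l : lincomb (repeat 0 (length l)) l = zero.
Proof.
induction l as [|v l IH]; simpl; [easy|].
rewrite IH, scal_0. apply plus_zero_l.
Qed.

Lemma in_combine_repeat l (a b : R) (u : V) :
  In (a, u) (combine (repeat b (length l)) l) -> a = b.
Proof. intros Hi. apply in_combine_l in Hi. now apply repeat_spec in Hi. Qed.

Lemma in_lincomb v l :
  In v l -> exists c, supported (eq v) c l /\ In 1 c /\ v = lincomb c l.
Proof.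
induction l as [|u l IH]; simpl; [easy|]. intros [->|Hv].
- exists (1 :: repeat 0 (length l)); repeat split; simpl.
  + now rewrite repeat_length.
  + intros a w [Hi|Hi]; [injection Hi; auto|left].
    now apply in_combine_repeat in Hi.
  + now left.
  + rewrite lincomb_zero, plus_zero_r. symmetry; apply scal_1.
- destruct (IH Hv) as (c & [Hlen Hs] & H1 & Hc).
  exists (0 :: c); repeat split; simpl.
  + now rewrite Hlen.
  + intros a w [Hi|Hi]; [injection Hi; auto|auto].
  + now right.
  + now rewrite scal_0, plus_zero_l.
Qed.

Lemma in_combine_add c d l (a : R) (u : V) :
  length c = length l -> length d = length l ->
  In (a, u) (combine (add_coefs c d) l) ->
  exists b b', a = b + b' /\ In (b, u) (combine c l) /\ In (b', u) (combine d l).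
Proof.
revert c d; induction l as [|v l IH]; intros [|b c] [|b' d]; simpl; intros Hc Hd;
  try easy.
injection Hc as Hc; injection Hd as Hd. intros [E|Hi].
- injection E as <- <-. exists b, b'; auto.
- destruct (IH c d Hc Hd Hi) as (x & y & -> & Hx & Hy). exists x, y; auto.
Qed.

Lemma in_combine_scal (b : R) c l (a : R) (u : V) :
  In (a, u) (combine (map (Rmult b) c) l) ->
  exists a', a = b * a' /\ In (a', u) (combine c l).
Proof.
revert l; induction c as [|a' c IH]; intros [|v l]; simpl; try easy.
intros [E|Hi].
- injection E as <- <-. exists a'; auto.
- destruct (IH l Hi) as (x & -> & Hx). exists x; auto.
Qed.

Lemma span_supported P l v :
  (forall u, P u -> In u l) -> span P v ->
  exists c, supported P c l /\ v = lincomb c l.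
Proof.
intros HP Hv; induction Hv as [|a u w Hu Hw (d & [Hd Sd] & ->)].
- exists (repeat 0 (length l)); split; [split|].
  + apply repeat_length.
  + intros a u Hi; left. now apply in_combine_repeat in Hi.
  + now rewrite lincomb_zero.
- destruct (in_lincomb u l (HP u Hu)) as (c & [Hc Sc] & _ & Ec).
  assert (Hc' : length (map (Rmult a) c) = length l) by now rewrite length_map.
  exists (add_coefs (map (Rmult a) c) d); split; [split|].
  + unfold add_coefs. rewrite length_map, length_combine, Hc', Hd. apply Nat.min_id.
  + intros b w Hi.
    destruct (in_combine_add _ _ _ _ _ Hc' Hd Hi) as (x & y & -> & Hx & Hy).
    destruct (in_combine_scal _ _ _ _ _ Hx) as (x' & -> & Hx').
    destruct (Sc _ _ Hx') as [->|<-]; [|now right].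
    destruct (Sd _ _ Hy) as [->|HPw]; [left; ring|now right].
  + rewrite lincomb_add, lincomb_scal, <- Ec; auto.
Qed.

Lemma span_list l v :
  span (fun u => In u l) v -> exists c, length c = length l /\ v = lincomb c l.
Proof.
intros Hv. destruct (span_supported _ l v (fun u Hu => Hu) Hv) as (c & [Hc _] & E).
now exists c.
Qed.

Lemma lincomb_in_span c l : span (fun u => In u l) (lincomb c l).
Proof.
revert c; induction l as [|v l IH]; intros [|a c]; simpl; try apply span_zero.
apply span_cons; [now left|].
apply (span_span (fun u => In u l)); [|apply IH].
intros u Hu; apply span_single; now right.
Qed.

Lemma lin_indep_eq l c d :
  lin_indep l -> length c = length l -> length d = length l ->
  lincomb c l = lincomb d l -> c = d.
Proof.
intros Hl Hc Hd E.
assert (Hd' : length (map (Rmult (-1)) d) = length l) by now rewrite length_map.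
assert (Hz : List.Forall (fun a => a = 0) (add_coefs c (map (Rmult (-1)) d))).
{ apply Hl.
  - unfold add_coefs. rewrite length_map, length_combine, Hc, Hd'. apply Nat.min_id.
  - rewrite lincomb_add, lincomb_scal, E; auto.
    change (-1) with (opp (@one R_Ring)). rewrite scal_opp_one.
    apply (plus_opp_r (lincomb d l)). }
assert (Hcd : length c = length d) by congruence.
clear -Hz Hcd. revert d Hz Hcd.
induction c as [|a c IH]; intros [|b d]; simpl; intros Hz Hcd; try discriminate; auto.
inversion Hz as [|x y Hx Hy]; subst. f_equal; [simpl in Hx; lra|auto].
Qed.

Lemma lin_indep_scal_eq0 l v a :
  lin_indep l -> In v l -> scal a v = zero -> a = 0.
Proof.
intros Hl Hv E. destruct (in_lincomb v l Hv) as (c & [Hc _] & H1 & Ev).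
assert (Hz : List.Forall (fun b => b = 0) (map (Rmult a) c)).
{ apply Hl; [now rewrite length_map|]. now rewrite lincomb_scal, <- Ev. }
rewrite Forall_forall in Hz. rewrite <- (Rmult_1_r a).
apply Hz. now apply in_map.
Qed.

(** Brackets of vector fields are only bilinear where derivatives exist, so
    bilinearity is relative to a set of vectors. *)
Definition bilinear_on br K : Prop :=
  (forall a u v w, K u -> K v -> K w ->
     br (plus (scal a u) v) w = plus (scal a (br u w)) (br v w))
  /\ (forall a u v w, K u -> K v -> K w ->
     br w (plus (scal a u) v) = plus (scal a (br w u)) (br w v)).

Lemma bilinear_on_incl br K P :
  (forall v, P v -> K v) -> bilinear_on br K -> bilinear_on br P.
Proof. intros HPK [Hl Hr]; split; intros; auto. Qed.

Lemma plus_self_zero (v : V) : v = plus v v -> v = zero.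
Proof.
intros E. apply (plus_reg_l v v zero).
rewrite plus_zero_r. symmetry; exact E.
Qed.

Lemma bilinear_zero_l br K w : bilinear_on br K -> K zero -> K w -> br zero w = zero.
Proof.
intros [Hl _] K0 Kw. apply plus_self_zero.
pose proof (Hl 1 zero zero w K0 K0 Kw) as E.
now rewrite plus_zero_r, scal_zero_r, scal_1 in E.
Qed.

Lemma bilinear_zero_r br K w : bilinear_on br K -> K zero -> K w -> br w zero = zero.
Proof.
intros [_ Hr] K0 Kw. apply plus_self_zero.
pose proof (Hr 1 zero zero w K0 K0 Kw) as E.
now rewrite plus_zero_r, scal_zero_r, scal_1 in E.
Qed.

Lemma span_bracket_closed br K P :
  bilinear_on br (span K) ->
  (forall u, P u -> K u) ->
  (forall u v, P u -> P v -> span P (br u v)) ->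
  forall u v, span P u -> span P v -> span P (br u v).
Proof.
intros Hb HPK HP u v Hu Hv.
assert (HS : forall w, span P w -> span K w).
{ intro w; apply span_span; intros x Hx; apply span_single; auto. }
induction Hu as [|a u u' HPu Hu IH].
- rewrite (bilinear_zero_l br (span K)); auto using span_zero.
- rewrite (proj1 Hb); auto using span_single.
  apply span_plus; [apply span_scal|assumption]. clear IH u' Hu.
  induction Hv as [|b w w' HPw Hw IH].
  + rewrite (bilinear_zero_r br (span K)); auto using span_zero, span_single.
  + rewrite (proj2 Hb); auto using span_single.
    apply span_plus; [apply span_scal; auto|assumption].
Qed.

Lemma subalgebra_span br P :
  bilinear_on br (span P) ->
  (forall u v, P u -> P v -> span P (br u v)) -> subalgebra br (span P).
Proof.
intros Hb HP; repeat split.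
- apply span_zero.
- apply span_plus.
- apply span_scal.
- now apply (span_bracket_closed br P).
Qed.

Lemma lincomb_weights br K t ws c l :
  bilinear_on br K -> K t -> (forall u, span (fun w => In w l) u -> K u) ->
  Forall2 (fun a r => br t r = scal a r) ws l -> length c = length l ->
  br t (lincomb c l) = lincomb (map (fun p => fst p * snd p) (combine ws c)) l.
Proof.
intros Hb Kt HK Hws; revert c.
induction Hws as [|a r ws l Hr Hws IH]; intros [|b c] Hlen; simpl; try discriminate.
- apply (bilinear_zero_r br K); auto. apply HK, span_zero.
- injection Hlen as Hlen.
  rewrite (proj2 Hb), Hr, IH; auto.
  + rewrite scal_assoc. f_equal. f_equal. apply Rmult_comm.
  + intros u Hu; apply HK. apply (span_span (fun w => In w l)); auto.
    intros; apply span_single; now right.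
  + apply HK, span_single; now left.
  + apply HK. apply (span_span (fun w => In w l)); [|apply lincomb_in_span].
    intros; apply span_single; now right.
Qed.

(** An abelian span [P] of basis vectors whose adjoint action is diagonal in
    the basis, without zero weight outside [P], is a Cartan subalgebra: an
    element normalizing it cannot have a component of nonzero weight. *)
Lemma cartan_of_weights br l P :
  lin_indep l -> (forall u, P u -> In u l) ->
  bilinear_on br (span (fun u => In u l)) ->
  (forall u v, br u v = opp (br v u)) ->
  (forall u v, P u -> P v -> br u v = zero) ->
  (forall t r, P t -> In r l -> exists a, br t r = scal a r) ->
  (forall r, In r l -> P r \/ exists t a, P t /\ a <> 0 /\ br t r = scal a r) ->
  cartan_subalgebra br (span (fun u => In u l)) (span P).
Proof.
intros Hl HP Hb Hanti Hab Hdiag Hnz.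
assert (Hsub : forall u, span P u -> span (fun u => In u l) u).
{ intro u; apply span_span; intros v Hv; apply span_single; auto. }
assert (HbP : bilinear_on br (span P)) by (eapply bilinear_on_incl; eauto).
assert (Hab' : forall u v, span P u -> span P v -> br u v = zero).
{ intros u v Hu Hv.
  induction Hu as [|a u u' HPu Hu IH].
  - apply (bilinear_zero_l br (span P)); auto using span_zero.
  - rewrite (proj1 HbP), IH, plus_zero_r; auto using span_single.
    transitivity (scal a (@zero V)); [f_equal|apply scal_zero_r].
    clear IH u' Hu. induction Hv as [|b w w' HPw Hw IH].
    + apply (bilinear_zero_r br (span P)); auto using span_zero, span_single.
    + rewrite (proj2 HbP), IH, plus_zero_r, Hab; auto using span_single.
      apply scal_zero_r. }
split; [exact Hsub|split; [|split]].
- apply subalgebra_span; auto.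
  intros u v Hu Hv. rewrite Hab; auto. apply span_zero.
- exists 1%nat. intros v Hv; simpl in Hv.
  revert v Hv. apply span_least; [easy| |].
  + intros a u v -> ->. rewrite scal_zero_r. apply plus_zero_r.
  + intros v (u & w & Hu & Hw & ->). now apply Hab'.
- intros u Hu Hn. destruct (span_list l u Hu) as (c & Hc & ->).
  apply span_lincomb; split; [exact Hc|].
  (* Since [br t u] lies in the span of [P], comparing coefficients kills the
     component of [u] along any [r] outside [P] with [br t r <> zero]. *)
  assert (Hkey : forall t, P t -> forall a r, In (a, r) (combine c l) ->
            a = 0 \/ P r \/ br t r = zero).
  { intros t Ht.
    assert (Hws : exists ws, Forall2 (fun a r => br t r = scal a r) ws l).
    { clear -Hdiag Ht. assert (H : forall r, In r l -> exists a, br t r = scal a r) by auto.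
      clear Hdiag. induction l as [|r l IH]; [now exists []|].
      destruct (H r) as [a Ha]; [now left|].
      destruct IH as [ws Hws]; [intros; apply H; now right|].
      now exists (a :: ws); constructor. }
    destruct Hws as [ws Hws].
    assert (Hin : span P (br t (lincomb c l))).
    { rewrite Hanti. apply span_opp, Hn. now apply span_single. }
    destruct (span_supported P l _ HP Hin) as (d & [Hd Sd] & Ed).
    rewrite (lincomb_weights br (span (fun u => In u l)) t ws) in Ed;
      auto using span_single.
    apply lin_indep_eq in Ed; auto.
    2:{ rewrite length_map, length_combine, Hc, (Forall2_length Hws). apply Nat.min_id. }
    clear -Hc Hws Sd Ed. subst d. revert c Hc Sd.
    induction Hws as [|x r' ws l Hr Hws IH]; intros [|b c] Hc Sd a r Hi;
      simpl in *; try easy.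
    destruct Hi as [E|Hi].
    - injection E as <- <-.
      destruct (Sd (x * b) r') as [E|HPr]; auto.
      destruct (Rmult_integral _ _ E) as [-> | ->]; auto.
      right; right. rewrite Hr. apply scal_0.
    - apply (IH c); auto. }
  intros a r Hi.
  destruct (Hnz r (in_combine_r _ _ _ _ Hi)) as [HPr|(t & x & Ht & Hx & E)]; auto.
  destruct (Hkey t Ht a r Hi) as [Ha|[HPr|Ez]]; auto.
  exfalso; apply Hx. rewrite Ez in E.
  apply (lin_indep_scal_eq0 l r x Hl (in_combine_r _ _ _ _ Hi)). now symmetry.
Qed.

End Spans.

(** * Isomorphism of Lie algebras with equal structure constants *)

Section Isomorphism.

Context {U V : ModuleSpace R_Ring}.
Variables (br : U -> U -> U) (br' : V -> V -> V) (l : list U) (l' : list V).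

Definition pair_bracket (p q : prod_ModuleSpace R_Ring U V) :
    prod_ModuleSpace R_Ring U V :=
  (br (fst p) (fst q), br' (snd p) (snd q)).

Definition graph : prod_ModuleSpace R_Ring U V -> Prop :=
  span (fun p => In p (combine l l')).

Lemma lincomb_combine c :
  length l = length l' ->
  @lincomb (prod_ModuleSpace R_Ring U V) c (combine l l')
  = (lincomb c l, lincomb c l').
Proof.
revert l' c; induction l as [|u k IH]; intros [|v k'] [|a c]; simpl; intros Hlen;
  try easy.
injection Hlen as Hlen. now rewrite IH.
Qed.

Hypothesis Hlen : length l = length l'.

Lemma graph_lincomb p :
  graph p <-> exists c, length c = length l /\ p = (lincomb c l, lincomb c l').
Proof.
split.
- intros Hp. destruct (span_list _ _ Hp) as (c & Hc & ->).
  exists c; split; [|now apply lincomb_combine].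
  rewrite Hc. etransitivity; [apply length_combine|].
  rewrite <- Hlen. apply Nat.min_id.
- intros (c & Hc & ->). rewrite <- lincomb_combine by assumption.
  apply lincomb_in_span.
Qed.

Hypotheses (Hl : lin_indep l) (Hl' : lin_indep l').
Hypothesis Hb : bilinear_on br (span (fun u => In u l)).
Hypothesis Hb' : bilinear_on br' (span (fun v => In v l')).
Hypothesis Hclosed : forall p q, In p (combine l l') -> In q (combine l l') ->
  graph (pair_bracket p q).

Lemma graph_fst p : graph p -> span (fun u => In u l) (fst p).
Proof.
intros Hp. apply graph_lincomb in Hp. destruct Hp as (c & _ & ->).
apply lincomb_in_span.
Qed.

Lemma graph_snd p : graph p -> span (fun v => In v l') (snd p).
Proof.
intros Hp. apply graph_lincomb in Hp. destruct Hp as (c & _ & ->).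
apply lincomb_in_span.
Qed.

Lemma graph_subalgebra : subalgebra pair_bracket graph.
Proof.
apply subalgebra_span; [|exact Hclosed].
split; intros a p q r Hp Hq Hr; apply injective_projections; simpl.
- now apply (proj1 Hb); apply graph_fst.
- now apply (proj1 Hb'); apply graph_snd.
- now apply (proj2 Hb); apply graph_fst.
- now apply (proj2 Hb'); apply graph_snd.
Qed.

Lemma graph_total u : span (fun u => In u l) u -> exists v, graph (u, v).
Proof.
intros Hu. destruct (span_list _ _ Hu) as (c & Hc & ->).
exists (lincomb c l'). apply graph_lincomb. now exists c.
Qed.

Lemma graph_functional u v w : graph (u, v) -> graph (u, w) -> v = w.
Proof.
rewrite !graph_lincomb. intros (c & Hc & E) (d & Hd & E').
injection E as -> ->. injection E' as E' ->.
now rewrite (lin_indep_eq l c d).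
Qed.

Lemma graph_injective u v w : graph (u, w) -> graph (v, w) -> u = v.
Proof.
rewrite !graph_lincomb. intros (c & Hc & E) (d & Hd & E').
injection E as -> ->. injection E' as -> E'.
rewrite (lin_indep_eq l' c d Hl'); auto.
- now rewrite Hc, Hlen.
- now rewrite Hd, Hlen.
Qed.

(** The graph is a subalgebra of the product because its generators are closed
    under the bracket, that is, because corresponding basis vectors have equal
    structure constants; independence of [l] makes it a function and independence
    of [l'] makes that function injective. *)
Lemma lie_isomorphic_of_graph :
  lie_isomorphic br (span (fun u => In u l)) br' (span (fun v => In v l')).
Proof.
pose (phi := fun u => epsilon (inhabits (@zero V)) (fun v => graph (u, v))).
assert (Hphi : forall u, span (fun u => In u l) u -> graph (u, phi u)).
{ intros u Hu. apply epsilon_spec. now apply graph_total. }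
destruct graph_subalgebra as (G0 & Gp & Gs & Gb).
assert (Hin : forall u v, graph (u, v) -> span (fun u => In u l) u).
{ intros u v Huv. exact (graph_fst _ Huv). }
assert (Huniq : forall u v, graph (u, v) -> phi u = v).
{ intros u v Huv. apply (graph_functional u); eauto. }
exists phi; repeat split.
- intros u Hu. exact (graph_snd _ (Hphi u Hu)).
- intros u v Hu Hv. apply Huniq. exact (Gp _ _ (Hphi u Hu) (Hphi v Hv)).
- intros a u Hu. apply Huniq. exact (Gs a _ (Hphi u Hu)).
- intros u v Hu Hv. apply Huniq. exact (Gb _ _ (Hphi u Hu) (Hphi v Hv)).
- intros u v Hu Hv E. apply (graph_injective u v (phi u)); auto.
  rewrite E; auto.
- intros w Hw. destruct (span_list _ _ Hw) as (c & Hc & ->).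
  assert (G : graph (lincomb c l, lincomb c l')).
  { apply graph_lincomb. exists c; split; [|reflexivity]. exact (eq_trans Hc (eq_sym Hlen)). }
  exists (lincomb c l); split; [|now apply Huniq]. apply lincomb_in_span.
Qed.

Lemma span_subalgebra_of_graph : subalgebra br (span (fun u => In u l)).
Proof.
apply subalgebra_span; [exact Hb|].
intros u v Hu Hv.
destruct (graph_total u) as [u' Hu']; [now apply span_single|].
destruct (graph_total v) as [v' Hv']; [now apply span_single|].
destruct graph_subalgebra as (_ & _ & _ & Gb).
exact (graph_fst _ (Gb _ _ Hu' Hv')).
Qed.

End Isomorphism.

(** * Derivations of the split octonions *)

Definition mx_vec (M : V3 * V3 * V3) (v : V3) : V3 :=
  let '(r1, r2, r3) := M in (dot r1 v, dot r2 v, dot r3 v).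

Definition mxT_vec (M : V3 * V3 * V3) (w : V3) : V3 :=
  let '(r1, r2, r3) := M in
  let '(w1, w2, w3) := w in
  plus (plus (scal w1 r1) (scal w2 r2)) (scal w3 r3).

Definition trace (M : V3 * V3 * V3) : R :=
  let '((m1, _, _), (_, m2, _), (_, _, m3)) := M in m1 + m2 + m3.

(** The decomposition [g2 = sl3 + V + V*]: a traceless matrix acts on [v] and
    dually on [w], while [x] and [y] are the derivations sending the idempotent
    [(1, 0, 0, 0)] to [(0, x, - y, 0)]. *)
Definition der (M : V3 * V3 * V3) (x y : V3) : oct_end := fun s =>
  let '(a, v, w, b) := s in
  (dot y v - dot x w,
   plus (plus (mx_vec M v) (scal (a - b) x)) (cross y w),
   minus (minus (opp (mxT_vec M w)) (scal (a - b) y)) (cross x v),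
   dot x w - dot y v).

Ltac oct_simpl :=
  repeat (progress (unfold commutator, minus, scal, plus, opp, zero, mult; simpl)).

Ltac oct_ring :=
  repeat (apply injective_projections); oct_simpl;
  change (ModuleSpace.sort R_Ring R_ModuleSpace) with R in *; ring.

Lemma der_linear M x y (s t : octonion) (a : R) :
  der M x y (plus (scal a s) t) = plus (scal a (der M x y s)) (der M x y t).
Proof.
destruct M as [[[[m11 m12] m13] [[m21 m22] m23]] [[m31 m32] m33]].
destruct x as [[x1 x2] x3], y as [[y1 y2] y3].
destruct s as [[[s0 [[s1 s2] s3]] [[s4 s5] s6]] s7].
destruct t as [[[t0 [[t1 t2] t3]] [[t4 t5] t6]] t7].
oct_ring.
Qed.

Lemma der_leibniz M x y (s t : octonion) : trace M = 0 ->
  der M x y (omul s t) = plus (omul (der M x y s) t) (omul s (der M x y t)).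
Proof.
destruct M as [[[[m11 m12] m13] [[m21 m22] m23]] [[m31 m32] m33]].
destruct x as [[x1 x2] x3], y as [[y1 y2] y3]. simpl; intros Htr.
assert (E : m33 = - m11 - m22) by lra. subst m33. clear Htr.
destruct s as [[[s0 [[s1 s2] s3]] [[s4 s5] s6]] s7].
destruct t as [[[t0 [[t1 t2] t3]] [[t4 t5] t6]] t7].
oct_ring.
Qed.

(** The matrix part of a bracket in [sl3 + V + V*]: the commutator of the
    matrices, and for the pairing of [V] with [V*] the traceless rank one matrix
    [3 x y'^T - (x, y') 1]. *)
Definition mx_bracket (M M' : V3 * V3 * V3) (x y x' y' : V3) : V3 * V3 * V3 :=
  let '(r1, r2, r3) := M in
  let '(r1', r2', r3') := M' in
  let '(x1, x2, x3) := x in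
  let '(x1', x2', x3') := x' in
  let t : R := dot x' y - dot x y' in
  let r (ri ri' : V3) (xi xi' : R) (e : V3) : V3 :=
    plus (minus (mxT_vec M' ri) (mxT_vec M ri'))
         (plus (minus (scal (3 * xi) y') (scal (3 * xi') y)) (scal t e)) in
  (r r1 r1' x1 x1' (1, 0, 0), r r2 r2' x2 x2' (0, 1, 0), r r3 r3' x3 x3' (0, 0, 1)).

(** Trace zero enters through [M x * v + x * M v = - M^T (x * v)] for the cross
    product [*]. *)
Lemma commutator_der M M' x y x' y' :
  trace M = 0 -> trace M' = 0 ->
  commutator (der M x y) (der M' x' y') =
  der (mx_bracket M M' x y x' y')
      (minus (minus (mx_vec M x') (mx_vec M' x)) (scal 2 (cross y y')))
      (plus (minus (mxT_vec M' y) (mxT_vec M y')) (scal 2 (cross x x'))).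
Proof.
intros Htr Htr'; apply functional_extensionality; intros [[[s0 [[s1 s2] s3]] [[s4 s5] s6]] s7].
destruct M as [[[[m11 m12] m13] [[m21 m22] m23]] [[m31 m32] m33]].
destruct x as [[x1 x2] x3], y as [[y1 y2] y3].
destruct M' as [[[[m11' m12'] m13'] [[m21' m22'] m23']] [[m31' m32'] m33']].
destruct x' as [[x1' x2'] x3'], y' as [[y1' y2'] y3'].
simpl in Htr, Htr'.
assert (E : m33 = - m11 - m22) by lra. subst m33.
assert (E' : m33' = - m11' - m22') by lra. subst m33'. clear Htr Htr'.
oct_ring.
Qed.

Definition vec (i : nat) : V3 :=
  match i with 1%nat => (1, 0, 0) | 2%nat => (0, 1, 0) | 3%nat => (0, 0, 1) | _ => (0, 0, 0) end.
Definition v0 : V3 := (0, 0, 0).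
Definition unit_mx (i j : nat) (a : R) : V3 * V3 * V3 :=
  let r k := if Nat.eqb k i then (scal a (vec j) : V3) else v0 in
  (r 1%nat, r 2%nat, r 3%nat).
Definition diag (a b c : R) : V3 * V3 * V3 := ((a, 0, 0), (0, b, 0), (0, 0, c)).
Definition mx0 : V3 * V3 * V3 := (v0, v0, v0).

(** The counterparts of [S1, ..., S6, h, H, L1, ..., L6], obtained by starting the
    iterated brackets from the three derivations [der mx0 (vec i) v0]. *)
Definition oct_basis : list oct_end :=
  [der mx0 (vec 1) v0; der mx0 (vec 2) v0; der mx0 (vec 3) v0;
   der mx0 v0 (scal 2 (vec 3)); der mx0 v0 (scal 2 (vec 1)); der mx0 v0 (scal 2 (vec 2));
   der (diag 2 2 (-4)) v0 v0; der (diag (-2) 4 (-2)) v0 v0;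
   der (unit_mx 1 3 6) v0 v0; der (unit_mx 2 3 6) v0 v0; der (unit_mx 2 1 6) v0 v0;
   der (unit_mx 3 1 6) v0 v0; der (unit_mx 3 2 6) v0 v0; der (unit_mx 1 2 6) v0 v0].

(** [sc i j k c] says that the bracket of the basis vectors number [i < j], in the
    order of [oct_basis] and counted from zero, has coefficient [c] on number [k]. *)
Definition sc (i j k : nat) (c : Z) := (i, j, k, c).

Definition structure_constants : list (nat * nat * nat * Z) :=
  [sc 0 1 3 1; sc 0 2 5 (-1); sc 0 3 8 1; sc 0 4 6 1; sc 0 4 7 (-1); sc 0 5 13 1;
   sc 0 6 0 (-2); sc 0 7 0 2; sc 0 10 1 (-6); sc 0 11 2 (-6); sc 1 2 4 1; sc 1 3 9 1;
   sc 1 4 10 1; sc 1 5 7 1; sc 1 6 1 (-2); sc 1 7 1 (-4); sc 1 12 2 (-6);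
   sc 1 13 0 (-6); sc 2 3 6 (-1); sc 2 4 11 1; sc 2 5 12 1; sc 2 6 2 4; sc 2 7 2 2;
   sc 2 8 0 (-6); sc 2 9 1 (-6); sc 3 4 1 (-8); sc 3 5 0 8; sc 3 6 3 (-4);
   sc 3 7 3 (-2); sc 3 11 4 6; sc 3 12 5 6; sc 4 5 2 (-8); sc 4 6 4 2; sc 4 7 4 (-2);
   sc 4 8 3 6; sc 4 13 5 6; sc 5 6 5 2; sc 5 7 5 4; sc 5 9 3 6; sc 5 10 4 6;
   sc 6 8 8 6; sc 6 9 9 6; sc 6 11 11 (-6); sc 6 12 12 (-6); sc 7 9 9 6; sc 7 10 10 6;
   sc 7 12 12 (-6); sc 7 13 13 (-6); sc 8 10 9 (-6); sc 8 11 6 12; sc 8 11 7 (-6);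
   sc 8 12 13 6; sc 9 11 10 6; sc 9 12 6 6; sc 9 12 7 6; sc 9 13 8 (-6);
   sc 10 12 11 (-6); sc 10 13 6 (-6); sc 10 13 7 12; sc 11 13 12 6].

Definition structure_coef (i j k : nat) : Z :=
  fold_right (fun e s => let '(i', j', k', c) := e in
    if Nat.eqb k' k then
      if (Nat.eqb i' i && Nat.eqb j' j)%bool then c
      else if (Nat.eqb i' j && Nat.eqb j' i)%bool then (- c)%Z else s
    else s) 0%Z structure_constants.

Definition structure_coefs (i j : nat) : list Z :=
  map (structure_coef i j) (seq 0 14).

Lemma lincomb_oct_basis c0 c1 c2 c3 c4 c5 c6 c7 c8 c9 c10 c11 c12 c13 :
  lincomb [c0; c1; c2; c3; c4; c5; c6; c7; c8; c9; c10; c11; c12; c13] oct_basis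
  = der ((2 * c6 - 2 * c7, 6 * c13, 6 * c8),
         (6 * c10, 2 * c6 + 4 * c7, 6 * c9),
         (6 * c11, 6 * c12, - 4 * c6 - 2 * c7))
        (c0, c1, c2) (2 * c4, 2 * c5, 2 * c3).
Proof.
apply functional_extensionality; intros [[[s0 [[s1 s2] s3]] [[s4 s5] s6]] s7].
oct_ring.
Qed.

(** By [commutator_der] and [lincomb_oct_basis] both sides are of the form
    [der M x y] with numerical entries. *)
Lemma commutator_oct_basis i j :
  (i < 14)%nat -> (j < 14)%nat ->
  commutator (nth i oct_basis zero) (nth j oct_basis zero)
  = lincomb (map IZR (structure_coefs i j)) oct_basis.
Proof.
intros Hi Hj.
do 14 (try destruct i as [|i]); try lia.
all: do 14 (try destruct j as [|j]); try lia.
all: cbv [structure_coefs structure_coef structure_constants sc map seq fst snd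
  fold_right Nat.eqb andb Z.opp].
all: rewrite lincomb_oct_basis; cbn [nth oct_basis].
all: rewrite commutator_der by (simpl; oct_simpl; ring).
all: f_equal; repeat apply injective_projections; oct_simpl; lra.
Qed.

Lemma der_split_g2 M x y : trace M = 0 -> split_g2 (der M x y).
Proof.
intros Htr; repeat split.
- intros s t. generalize (der_linear M x y s t 1). now rewrite !scal_1.
- intros a s. generalize (der_linear M x y s zero a).
  intros E. rewrite plus_zero_r in E. rewrite E.
  replace (der M x y zero) with (@zero octonion); [apply plus_zero_r|].
  generalize (der_linear M x y zero zero 1).
  rewrite !scal_1, plus_zero_r. intros E0. symmetry. now apply plus_self_zero.
- intros s t. now apply der_leibniz.
Qed.

Ltac oct_simpl_in H :=
  repeat (progress (unfold minus, scal, plus, opp, zero, mult in H; simpl in H)).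

Definition part_a (s : octonion) : R := fst (fst (fst s)).
Definition part_v (s : octonion) : V3 := snd (fst (fst s)).

Ltac read H := unfold part_a, part_v in H; oct_simpl_in H.

Definition oct_v (i : nat) : octonion := (0, vec i, v0, 0).

(** The three octonions [oct_v i] generate: the products of two of them give the
    component [w], and products of three give the two idempotents. *)
Lemma derivation_ext D D' :
  split_g2 D -> split_g2 D' ->
  (forall i, (1 <= i <= 3)%nat -> D (oct_v i) = D' (oct_v i)) -> D = D'.
Proof.
intros (Hp & Hs & Hm) (Hp' & Hs' & Hm') Hv.
assert (H1 := Hv 1%nat ltac:(lia)). assert (H2 := Hv 2%nat ltac:(lia)).
assert (H3 := Hv 3%nat ltac:(lia)). clear Hv.
assert (Hw : forall s t, D s = D' s -> D t = D' t -> D (omul s t) = D' (omul s t)).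
{ intros s t Es Et. now rewrite Hm, Hm', Es, Et. }
assert (Hl : forall a s t, D s = D' s -> D t = D' t ->
          D (plus (scal a s) t) = D' (plus (scal a s) t)).
{ intros a s t Es Et. now rewrite Hp, Hp', Hs, Hs', Es, Et. }
assert (W1 := Hw _ _ H2 H3). assert (W2 := Hw _ _ H3 H1). assert (W3 := Hw _ _ H1 H2).
assert (F := Hw _ _ H1 W1). assert (G := Hw _ _ W1 H1).
apply functional_extensionality; intro s.
destruct s as [[[s0 [[s1 s2] s3]] [[s4 s5] s6]] s7].
pose (t := plus (scal (- s0) (omul (oct_v 1) (omul (oct_v 2) (oct_v 3))))
  (plus (scal (- s7) (omul (omul (oct_v 2) (oct_v 3)) (oct_v 1)))
  (plus (scal s1 (oct_v 1)) (plus (scal s2 (oct_v 2)) (plus (scal s3 (oct_v 3))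
  (plus (scal (- s4) (omul (oct_v 2) (oct_v 3))) (plus (scal (- s5) (omul (oct_v 3) (oct_v 1)))
  (plus (scal (- s6) (omul (oct_v 1) (oct_v 2))) (scal 0 (oct_v 1))))))))) : octonion).
assert (Et : t = (s0, (s1, s2, s3), (s4, s5, s6), s7)) by (unfold t; oct_ring).
assert (K : D t = D' t).
{ unfold t. repeat (apply Hl; [assumption|]). now rewrite Hs, Hs', H1. }
rewrite Et in K. exact K.
Qed.

(** Let [v_i] be [oct_v i], [e] the idempotent [(1, 0, 0, 0)] and
    [D v_i = (a_i, m_i, n_i, b_i)]. The relations [v_i v_j + v_j v_i = 0] make the
    matrix with columns [n_i] antisymmetric, hence a cross product with some [x],
    and give [b_i = - a_i]; the [m_i] are the columns of [M] and the [a_i] the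
    entries of [y]. From [v_1 (v_2 v_3) = - e] the trace of [M] is the first entry
    of [D e], which vanishes because [e e = e]. *)
Lemma derivation_is_der D : split_g2 D -> exists M x y, trace M = 0 /\ D = der M x y.
Proof.
intros HD. assert (HD' := HD). destruct HD' as (Hp & Hs & Hm).
assert (H0 : D zero = zero).
{ apply plus_self_zero. now rewrite <- Hp, plus_zero_r. }
destruct (D (oct_v 1)) as [[[a1 [[m11 m21] m31]] [[n11 n21] n31]] b1] eqn:E1.
destruct (D (oct_v 2)) as [[[a2 [[m12 m22] m32]] [[n12 n22] n32]] b2] eqn:E2.
destruct (D (oct_v 3)) as [[[a3 [[m13 m23] m33]] [[n13 n23] n33]] b3] eqn:E3.
assert (Z : forall i j, (1 <= i <= 3)%nat -> (1 <= j <= 3)%nat ->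
   plus (omul (oct_v i) (oct_v j)) (omul (oct_v j) (oct_v i)) = zero).
{ intros i j Hi Hj.
  assert (Ci : i = 1%nat \/ i = 2%nat \/ i = 3%nat) by lia.
  assert (Cj : j = 1%nat \/ j = 2%nat \/ j = 3%nat) by lia.
  destruct Ci as [-> | [-> | ->]], Cj as [-> | [-> | ->]]; oct_ring. }
assert (Z' : forall i j, (1 <= i <= 3)%nat -> (1 <= j <= 3)%nat ->
   plus (plus (omul (D (oct_v i)) (oct_v j)) (omul (oct_v i) (D (oct_v j))))
    (plus (omul (D (oct_v j)) (oct_v i)) (omul (oct_v j) (D (oct_v i)))) = zero).
{ intros i j Hi Hj. rewrite <- !Hm, <- Hp, Z; auto. }
destruct (D (1, v0, v0, 0)) as [[[a4 [[m14 m24] m34]] [[n14 n24] n34]] b4] eqn:E4.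
assert (T : omul (oct_v 1) (omul (oct_v 2) (oct_v 3)) = scal (-1) ((1, v0, v0, 0) : octonion)).
{ oct_ring. }
assert (T1 := f_equal D T). rewrite Hs in T1.
assert (I : omul (1, v0, v0, 0) (1, v0, v0, 0) = (1, v0, v0, 0)) by oct_ring.
assert (I1 := f_equal D I).
rewrite Hm, E4 in I1. rewrite Hm, (Hm (oct_v 2) (oct_v 3)), E1, E2, E3, E4 in T1.
assert (Z11 := Z' 1%nat 1%nat ltac:(lia) ltac:(lia)).
assert (Z12 := Z' 1%nat 2%nat ltac:(lia) ltac:(lia)).
assert (Z13 := Z' 1%nat 3%nat ltac:(lia) ltac:(lia)).
assert (Z22 := Z' 2%nat 2%nat ltac:(lia) ltac:(lia)).
assert (Z23 := Z' 2%nat 3%nat ltac:(lia) ltac:(lia)).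
assert (Z33 := Z' 3%nat 3%nat ltac:(lia) ltac:(lia)).
clear Z Z' T I Hp Hs Hm H0.
rewrite E1 in Z11, Z12, Z13; rewrite E2 in Z12, Z22, Z23; rewrite E3 in Z13, Z23, Z33.
change (ModuleSpace.sort R_Ring R_ModuleSpace) with R in *.
assert (A4 : a4 = 0) by (apply (f_equal part_a) in I1; read I1; lra).
assert (Htr : m11 + m22 + m33 = 0).
{ apply (f_equal part_a) in T1; read T1; lra. }
assert (N11 : n11 = 0) by (apply (f_equal part_a) in Z11; read Z11; lra).
assert (N22 : n22 = 0) by (apply (f_equal part_a) in Z22; read Z22; lra).
assert (N33 : n33 = 0) by (apply (f_equal part_a) in Z33; read Z33; lra).
assert (N12 : n21 = - n12) by (apply (f_equal part_a) in Z12; read Z12; lra).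
assert (N13 : n13 = - n31) by (apply (f_equal part_a) in Z13; read Z13; lra).
assert (N23 : n32 = - n23) by (apply (f_equal part_a) in Z23; read Z23; lra).
assert (B1 : b1 = - a1).
{ apply (f_equal (fun s => fst (fst (part_v s)))) in Z11; read Z11; lra. }
assert (B2 : b2 = - a2).
{ apply (f_equal (fun s => snd (fst (part_v s)))) in Z22; read Z22; lra. }
assert (B3 : b3 = - a3).
{ apply (f_equal (fun s => snd (part_v s))) in Z33; read Z33; lra. }
clear Z11 Z12 Z13 Z22 Z23 Z33 T1 I1 E4. subst.
exists ((m11, m12, m13), (m21, m22, m23), (m31, m32, m33)), (n23, n31, n12), (a1, a2, a3).
split; [exact Htr|].
apply derivation_ext; auto using der_split_g2.
intros i Hi. assert (Ci : i = 1%nat \/ i = 2%nat \/ i = 3%nat) by lia.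
destruct Ci as [-> | [-> | ->]]; rewrite ?E1, ?E2, ?E3;
 unfold oct_v, vec, v0; repeat apply injective_projections; oct_simpl; lra.
Qed.

Lemma split_g2_span D : split_g2 D <-> span (fun u => In u oct_basis) D.
Proof.
split; intros HD.
- destruct (derivation_is_der D HD) as (M & x & y & Htr & ->).
  destruct M as [[[[m11 m12] m13] [[m21 m22] m23]] [[m31 m32] m33]].
  destruct x as [[x1 x2] x3], y as [[y1 y2] y3]. simpl in Htr.
  assert (E : m33 = - m11 - m22) by lra. subst m33.
  (* The diagonal of [M] is split along [diag 2 2 (-4)] and [diag (-2) 4 (-2)]. *)
  replace (der _ _ _) with (lincomb
    [x1; x2; x3; y3 / 2; y1 / 2; y2 / 2; (2 * m11 + m22) / 6; (m22 - m11) / 6;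
     m13 / 6; m23 / 6; m21 / 6; m31 / 6; m32 / 6; m12 / 6] oct_basis).
  { apply lincomb_in_span. }
  rewrite lincomb_oct_basis.
  f_equal; repeat apply injective_projections; simpl; field.
- destruct (span_list _ _ HD) as (c & Hc & ->). simpl in Hc.
  do 14 (destruct c as [|? c]; [discriminate|]).
  destruct c; [|discriminate].
  rewrite lincomb_oct_basis. apply der_split_g2. simpl. ring.
Qed.

Lemma oct_basis_indep : lin_indep oct_basis.
Proof.
intros c Hc E. simpl in Hc.
do 14 (destruct c as [|? c]; [discriminate|]).
destruct c; [|discriminate].
rewrite lincomb_oct_basis in E.
assert (H1 := f_equal (fun D : oct_end => D (oct_v 1)) E).
assert (H2 := f_equal (fun D : oct_end => D (oct_v 2)) E).
assert (H3 := f_equal (fun D : oct_end => D (oct_v 3)) E).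
clear E. oct_simpl_in H1. oct_simpl_in H2. oct_simpl_in H3.
injection H1; injection H2; injection H3; intros.
change (ModuleSpace.sort R_Ring R_ModuleSpace) with R in *.
repeat (progress (unfold scal, plus, opp, zero, mult in *; simpl in *)).
repeat constructor; lra.
Qed.

Lemma commutator_bilinear : bilinear_on commutator (span (fun u => In u oct_basis)).
Proof.
apply bilinear_on_incl with (K := split_g2); [intro D; apply split_g2_span|].
split; intros a D D' E HD HD' HE; apply functional_extensionality; intro s;
 destruct HD as (Dp & Ds & _), HE as (Ep & Es & _), HD' as (Dp' & Ds' & _).
- change (minus (plus (scal a (D (E s))) (D' (E s))) (E (plus (scal a (D s)) (D' s)))
    = plus (scal a (minus (D (E s)) (E (D s)))) (minus (D' (E s)) (E (D' s)))).
  rewrite Ep, Es.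
  generalize (D (E s)) (D' (E s)) (E (D s)) (E (D' s)); intros s1 s2 s3 s4.
  clear. oct_ring.
- change (minus (E (plus (scal a (D s)) (D' s))) (plus (scal a (D (E s))) (D' (E s)))
    = plus (scal a (minus (E (D s)) (D (E s)))) (minus (E (D' s)) (D' (E s)))).
  rewrite Ep, Es.
  generalize (D (E s)) (D' (E s)) (E (D s)) (E (D' s)); intros s1 s2 s3 s4.
  clear. oct_ring.
Qed.

(** * An exactly computable ring of coefficient functions *)

Arguments Q2R _ : simpl never.
Arguments Qred _ : simpl never.

(** [Gauss a b] stands for [a + b j], where [j = eps * i]. *)
Record gauss := Gauss { g1 : Q; gj : Q }.

Definition gadd (a b : gauss) := Gauss (Qred (g1 a + g1 b)) (Qred (gj a + gj b)).

Definition gmul (a b : gauss) :=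
  Gauss (Qred (g1 a * g1 b - gj a * gj b)) (Qred (g1 a * gj b + gj a * g1 b)).

Definition gzero (a : gauss) : bool := Qeq_bool (g1 a) 0 && Qeq_bool (gj a) 0.

(** [Mono u w a b c] stands for
    [exp (j * u * x / 6 + w * z / 2) * y ^ a * p ^ b * q ^ c]. *)
Record mono := Mono { mu : Z; mw : Z; my : nat; mp : nat; mq : nat }.

Definition mone := Mono 0 0 0 0 0.

Definition meq (m n : mono) : bool :=
  Z.eqb (mu m) (mu n) && Z.eqb (mw m) (mw n) && Nat.eqb (my m) (my n)
  && Nat.eqb (mp m) (mp n) && Nat.eqb (mq m) (mq n).

Definition mmul (m n : mono) :=
  Mono (mu m + mu n) (mw m + mw n) (my m + my n) (mp m + mp n) (mq m + mq n).

Definition poly := list (gauss * mono).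

Fixpoint pins (c : gauss) (m : mono) (P : poly) : poly :=
  match P with
  | [] => [(c, m)]
  | (d, n) :: P' => if meq m n then (gadd c d, m) :: P' else (d, n) :: pins c m P'
  end.

Definition padd (P Q : poly) : poly := fold_right (fun e => pins (fst e) (snd e)) Q P.

Definition pscal (c : gauss) (m : mono) (P : poly) : poly :=
  map (fun e => (gmul c (fst e), mmul m (snd e))) P.

Definition pmul (P Q : poly) : poly :=
  fold_right (fun e => padd (pscal (fst e) (snd e) Q)) [] P.

Definition prune (P : poly) : poly := filter (fun e => negb (gzero (fst e))) P.

Definition gnat (n : nat) : gauss := Gauss (inject_Z (Z.of_nat n)) 0.

Definition mdiff (j : coord) (m : mono) : gauss * mono :=
  let (u, w, a, b, c) := m in
  match j with
  | cx => (Gauss 0 (u # 6), m)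
  | cy => (gnat a, Mono u w (pred a) b c)
  | cz => (Gauss (w # 2) 0, m)
  | cp => (gnat b, Mono u w a (pred b) c)
  | cq => (gnat c, Mono u w a b (pred c))
  end.

Definition pdiff (j : coord) (P : poly) : poly :=
  prune (map (fun e => (gmul (fst e) (fst (mdiff j (snd e))), snd (mdiff j (snd e)))) P).

(** Vector fields by components, as a record rather than a function of [coord] so
    that evaluating a field computes its components once. *)
Record fld := Fld { fx : poly; fy : poly; fz : poly; fp : poly; fq : poly }.

Definition comp (V : fld) (k : coord) : poly :=
  match k with cx => fx V | cy => fy V | cz => fz V | cp => fp V | cq => fq V end.

Definition fmap (F : coord -> poly) : fld := Fld (F cx) (F cy) (F cz) (F cp) (F cq).

Definition fadd (V W : fld) : fld := fmap (fun k => padd (comp V k) (comp W k)).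

Definition fscal (P : poly) (V : fld) : fld := fmap (fun k => pmul P (comp V k)).

Definition psum (F : coord -> poly) : poly :=
  padd (F cx) (padd (F cy) (padd (F cz) (padd (F cp) (F cq)))).

Definition fbracket (V W : fld) : fld :=
  fmap (fun k => prune (psum (fun j =>
    padd (pmul (comp V j) (pdiff j (comp W k)))
         (pscal (Gauss (-1) 0) mone (pmul (comp W j) (pdiff j (comp V k))))))).

Definition fzero (V : fld) : bool :=
  forallb (fun k => forallb (fun e => gzero (fst e)) (comp V k)) [cx; cy; cz; cp; cq].

Ltac C_ring := match goal with |- ?a = ?b => change (@eq C a b) end; ring.

Section Evaluation.

Variable eps : R.
Hypothesis Heps : eps * eps = 1.

Definition gval (c : gauss) : C := (Q2R (g1 c), eps * Q2R (gj c)).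

Definition mval (m : mono) (t : point) : C :=
  let r := exp (IZR (mw m) * t cz / 2) * t cy ^ my m * t cp ^ mp m * t cq ^ mq m in
  let a := eps * IZR (mu m) * t cx / 6 in
  (r * cos a, r * sin a).

Definition peval (P : poly) (t : point) : C :=
  fold_right (fun e s => gval (fst e) * mval (snd e) t + s)%C (RtoC 0) P.

Definition feval (V : fld) : vfield := fun t k => peval (comp V k) t.

Lemma Q2R_red q : Q2R (Qred q) = Q2R q.
Proof. apply Qeq_eqR, Qred_correct. Qed.

Lemma gval_add a b : gval (gadd a b) = (gval a + gval b)%C.
Proof.
apply injective_projections; simpl; rewrite !Q2R_red, Q2R_plus; ring.
Qed.

(** For [j = eps * i], the relation [j ^ 2 = -1] is the hypothesis on [eps]. *)
Lemma gval_mul a b : gval (gmul a b) = (gval a * gval b)%C.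
Proof.
apply injective_projections; simpl; rewrite !Q2R_red, ?Q2R_plus, ?Q2R_minus, !Q2R_mult.
- replace (eps * Q2R (gj a) * (eps * Q2R (gj b)))
    with (eps * eps * (Q2R (gj a) * Q2R (gj b))) by ring.
  rewrite Heps. ring.
- ring.
Qed.

Lemma gval_zero a : gzero a = true -> gval a = RtoC 0.
Proof.
intros H. apply andb_prop in H as [H1 H2].
apply Qeq_bool_eq in H1. apply Qeq_bool_eq in H2.
apply injective_projections; simpl; [rewrite (Qeq_eqR _ _ H1)|rewrite (Qeq_eqR _ _ H2)];
  unfold Q2R; simpl; ring.
Qed.

Lemma mval_mul a b t : mval (mmul a b) t = (mval a t * mval b t)%C.
Proof.
unfold mval; apply injective_projections; simpl;
  rewrite !plus_IZR, !pow_add;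
  replace ((IZR (mw a) + IZR (mw b)) * t cz / 2)
    with (IZR (mw a) * t cz / 2 + IZR (mw b) * t cz / 2) by field;
  replace (eps * (IZR (mu a) + IZR (mu b)) * t cx / 6)
    with (eps * IZR (mu a) * t cx / 6 + eps * IZR (mu b) * t cx / 6) by field;
  rewrite exp_plus, ?cos_plus, ?sin_plus; ring.
Qed.

Lemma mval_one t : mval mone t = RtoC 1.
Proof.
unfold mval; apply injective_projections; simpl;
  replace (0 * t cz / 2) with 0 by field; replace (eps * 0 * t cx / 6) with 0 by field;
  rewrite exp_0, ?cos_0, ?sin_0; ring.
Qed.

Lemma meq_eq a b : meq a b = true -> a = b.
Proof.
destruct a, b; unfold meq; simpl; rewrite !Bool.andb_true_iff, !Z.eqb_eq, !Nat.eqb_eq.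
now intros ((((-> & ->) & ->) & ->) & ->).
Qed.

Lemma peval_pins c m P t : peval (pins c m P) t = (gval c * mval m t + peval P t)%C.
Proof.
induction P as [|[d n] P IH]; simpl; [easy|].
destruct (meq m n) eqn:E; simpl.
- apply meq_eq in E; subst n. rewrite gval_add. ring.
- rewrite IH. ring.
Qed.

Lemma peval_add P Q t : peval (padd P Q) t = (peval P t + peval Q t)%C.
Proof.
induction P as [|[c m] P IH]; simpl; [ring|]. rewrite peval_pins, IH. ring.
Qed.

Lemma peval_scal c m P t : peval (pscal c m P) t = (gval c * mval m t * peval P t)%C.
Proof.
induction P as [|[d n] P IH]; simpl; [ring|].
rewrite IH, gval_mul, mval_mul. ring.
Qed.

Lemma peval_mul P Q t : peval (pmul P Q) t = (peval P t * peval Q t)%C.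
Proof.
induction P as [|[c m] P IH]; simpl; [ring|].
rewrite peval_add, peval_scal, IH. ring.
Qed.

Lemma peval_prune P t : peval (prune P) t = peval P t.
Proof.
induction P as [|[c m] P IH]; simpl; [easy|].
destruct (gzero c) eqn:E; simpl; rewrite IH; [rewrite (gval_zero c E)|]; ring.
Qed.

Definition is_partial (j : coord) (f : point -> C) (t : point) (d : C) : Prop :=
  is_derive (fun s => Re (f (upd t j s))) (t j) (Re d)
  /\ is_derive (fun s => Im (f (upd t j s))) (t j) (Im d).

Lemma is_partial_unique j f t d : is_partial j f t d -> partial j f t = d.
Proof.
intros [HR HI].
apply injective_projections; simpl; now apply is_derive_unique.
Qed.

Lemma is_partial_plus j f g t d e :
  is_partial j f t d -> is_partial j g t e ->
  is_partial j (fun s => f s + g s)%C t (d + e)%C.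
Proof.
intros [HR HI] [HR' HI']; split; simpl; now apply @is_derive_plus.
Qed.

Lemma is_partial_mult_const j c f t d :
  is_partial j f t d -> is_partial j (fun s => c * f s)%C t (c * d)%C.
Proof.
intros [HR HI]; split; simpl.
- apply (is_derive_minus (fun s => fst c * _) (fun s => snd c * _));
  now apply is_derive_scal.
- apply (is_derive_plus (fun s => fst c * _) (fun s => snd c * _));
  now apply is_derive_scal.
Qed.

Lemma is_partial_lin j a f g t d e :
  is_partial j f t d -> is_partial j g t e ->
  is_partial j (fun s => plus (scal (V := C_R_ModuleSpace) a (f s)) (g s)) t
    (RtoC a * d + e)%C.
Proof.
intros [HR HI] Hg.
apply (is_partial_plus j (fun s => scal (V := C_R_ModuleSpace) a (f s)) g); [|exact Hg].
split; simpl.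
- replace (a * fst d - 0 * snd d) with (a * fst d) by ring. now apply is_derive_scal.
- replace (a * snd d + 0 * fst d) with (a * snd d) by ring. now apply is_derive_scal.
Qed.

Lemma is_partial_const j c t : is_partial j (fun _ => c) t (RtoC 0).
Proof. split; simpl; apply @is_derive_const. Qed.

Lemma Q2R_0 : Q2R 0 = 0.
Proof. unfold Q2R; simpl; ring. Qed.

Lemma Q2R_nat n : Q2R (inject_Z (Z.of_nat n)) = INR n.
Proof. unfold Q2R; simpl. rewrite INR_IZR_INZ. field. Qed.

Lemma is_partial_mono j m t :
  is_partial j (mval m) t (gval (fst (mdiff j m)) * mval (snd (mdiff j m)) t)%C.
Proof.
destruct m as [u w a b n].
destruct j; split; unfold mval, upd; simpl; rewrite ?Q2R_0, ?Q2R_nat;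
  auto_derive; auto; unfold Q2R, Rdiv; simpl; field.
Qed.

Lemma is_partial_peval j P t : is_partial j (peval P) t (peval (pdiff j P) t).
Proof.
unfold pdiff. rewrite peval_prune.
induction P as [|[c m] P IH]; simpl; [apply is_partial_const|].
apply is_partial_plus; [|exact IH].
rewrite gval_mul, <- Cmult_assoc. apply is_partial_mult_const, is_partial_mono.
Qed.

Lemma comp_fmap F k : comp (fmap F) k = F k.
Proof. now destruct k. Qed.

(** The ring of coefficients is closed under the partial derivatives, so brackets
    of its fields are computed exactly. *)
Lemma lie_bracket_feval V W : lie_bracket (feval V) (feval W) = feval (fbracket V W).
Proof.
apply functional_extensionality; intro t; apply functional_extensionality; intro k.
unfold lie_bracket, feval, fbracket. rewrite comp_fmap, peval_prune.
unfold psum, sum_coord. rewrite !peval_add, !peval_scal, !peval_mul.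
rewrite !(fun j => is_partial_unique j _ t _ (is_partial_peval j (comp V k) t)).
rewrite !(fun j => is_partial_unique j _ t _ (is_partial_peval j (comp W k) t)).
rewrite mval_one. replace (gval (Gauss (-1) 0)) with (RtoC (-1)).
{ C_ring. }
apply injective_projections; unfold gval, Q2R; simpl; field.
Qed.

(** The total derivative [Derive] is additive only where derivatives exist, so
    brackets are known to be bilinear on these fields only. *)
Definition smooth (V : vfield) : Prop :=
  forall j k t, exists d, is_partial j (fun s => V s k) t d.

Lemma smooth_feval V : smooth (feval V).
Proof. intros j k t. eexists. apply is_partial_peval. Qed.

End Evaluation.

Lemma lie_bracket_antisym V W : lie_bracket V W = opp (lie_bracket W V).
Proof.
apply functional_extensionality; intro t; apply functional_extensionality; intro k.
transitivity (- lie_bracket W V t k)%C; [|reflexivity].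
unfold lie_bracket, sum_coord. C_ring.
Qed.

Lemma smooth_lin a V W : smooth V -> smooth W -> smooth (plus (scal a V) W).
Proof.
intros HV HW j k t.
destruct (HV j k t) as [d Hd], (HW j k t) as [e He]. exists (RtoC a * d + e)%C.
now apply (is_partial_lin j a (fun s => V s k) (fun s => W s k)).
Qed.

Lemma partial_lin j a V W t k :
  smooth V -> smooth W ->
  partial j (fun s => plus (scal a V) W s k) t
  = (RtoC a * partial j (fun s => V s k) t + partial j (fun s => W s k) t)%C.
Proof.
intros HV HW. destruct (HV j k t) as [d Hd], (HW j k t) as [e He].
rewrite (is_partial_unique _ _ _ _ Hd), (is_partial_unique _ _ _ _ He).
apply is_partial_unique.
now apply (is_partial_lin j a (fun s => V s k) (fun s => W s k)).
Qed.

Lemma C_scal (a : R) (c : C) : scal (V := C_R_ModuleSpace) a c = (RtoC a * c)%C.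
Proof. apply injective_projections; simpl; unfold scal; simpl; unfold mult; simpl; ring. Qed.

Lemma lie_bracket_bilinear : bilinear_on lie_bracket smooth.
Proof.
assert (Hl : forall a U V W, smooth U -> smooth V -> smooth W ->
  lie_bracket (plus (scal a U) V) W = plus (scal a (lie_bracket U W)) (lie_bracket V W)).
{ intros a U V W HU HV HW.
  apply functional_extensionality; intro t; apply functional_extensionality; intro k.
  transitivity (RtoC a * lie_bracket U W t k + lie_bracket V W t k)%C.
  - unfold lie_bracket, sum_coord. rewrite !partial_lin by assumption.
    assert (E : forall j, plus (scal a U) V t j = (RtoC a * U t j + V t j)%C).
    { intro j. rewrite <- C_scal. reflexivity. }
    rewrite !E. C_ring.
  - rewrite <- C_scal. reflexivity. }
split; [exact Hl|].
intros a U V W HU HV HW.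
rewrite lie_bracket_antisym, Hl by assumption.
rewrite (lie_bracket_antisym W U), (lie_bracket_antisym W V).
apply opp_lin.
Qed.

(** * The fields of the rolling distribution *)

Definition pc (a b : Q) : poly := [(Gauss a b, mone)].
Definition pexp (u w : Z) : poly := [(Gauss 1 0, Mono u w 0 0 0)].
Definition py : poly := [(Gauss 1 0, Mono 0 0 1 0 0)].
Definition pp : poly := [(Gauss 1 0, Mono 0 0 0 1 0)].
Definition pq : poly := [(Gauss 1 0, Mono 0 0 0 0 1)].

Declare Scope poly_scope.
Delimit Scope poly_scope with poly.
Bind Scope poly_scope with poly.
Infix "+" := padd : poly_scope.
Infix "*" := pmul : poly_scope.

(** In terms of [j], the fields [E1], [E3] and [X2] are [eps] times fields without
    sign; [sym_E1], [sym_E3] and [sym_X2] are the latter. *)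
Definition sym_E1 : fld :=
  Fld [] (pc 0 (1 # 2) * (py * py + pc (-1) 0)) (pc 0 (-1) * py)
      (pc 0 (-1 # 2) * (pc 2 0 * py * pp + pc 1 0)) [].
Definition sym_E2 : fld :=
  Fld [] (pc (1 # 2) 0 * (py * py + pc 1 0)) (pc (-1) 0 * py)
      (pc (-1 # 2) 0 * (pc 2 0 * py * pp + pc 1 0)) [].
Definition sym_E3 : fld := Fld [] (pc 0 1 * py) (pc 0 (-1)) (pc 0 (-1) * pp) [].
Definition sym_X1 : fld := fadd (Fld (pc 1 0) [] [] [] []) (fscal (pc (-1) 0) sym_E2).
Definition sym_X2 : fld :=
  fadd (Fld [] [] [] [] (pc 0 1))
    (fadd (fscal (pc (-1) 0 * pexp 2 0) sym_E1) (fscal (pc 0 (1 # 3) * pexp 2 0) sym_E3)).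
Definition sym_S1 : fld :=
  fadd (fscal (pc 0 (3 # 4) * pexp 1 (-1) * ((py + pc 0 1) * pp + pc 1 0)) sym_X1)
    (fscal (pc (-3 # 2) 0 * pexp (-1) (-1) * ((py + pc 0 (-1)) * pp + pc 1 0)) sym_X2).
Definition sym_S2 : fld :=
  fadd (fscal (pc 0 (-3 # 4) * pexp 1 1 * (py + pc 0 1)) sym_X1)
    (fscal (pc (3 # 2) 0 * pexp (-1) 1 * (py + pc 0 (-1))) sym_X2).
Definition sym_S3 : fld :=
  fadd (fscal (pc 0 (-4) * pq) sym_X1)
   (fadd (fscal (pc 0 (2 # 3) * (pq * pq + pc (-9) 0 * pexp (-4) 0)) sym_X2)
     (fscal (pc (-2 # 9) 0 * pq * pq * pexp 2 0)
        (fadd (fscal (pc 5 0) sym_E3) (fscal (pc 0 3) sym_E1)))).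

Section Fields.
Variable eps : R.
Hypothesis Heps : eps = 1 \/ eps = -1.

Lemma peval_pc a b t : peval eps (pc a b) t = (Q2R a, eps * Q2R b).
Proof.
unfold pc; simpl. rewrite mval_one. apply injective_projections; simpl; ring.
Qed.

Lemma peval_monomial m t : peval eps [(Gauss 1 0, m)] t = mval eps m t.
Proof.
simpl. replace (gval eps (Gauss 1 0)) with (RtoC 1); [ring|].
apply injective_projections; unfold gval, Q2R; simpl; field.
Qed.

Lemma peval_coordinates t :
  peval eps py t = RtoC (t cy) /\ peval eps pp t = RtoC (t cp)
  /\ peval eps pq t = RtoC (t cq).
Proof.
unfold py, pp, pq. rewrite !peval_monomial.
repeat split; unfold mval; apply injective_projections; simpl;
  replace (0 * t cz / 2) with 0 by field; replace (eps * 0 * t cx / 6) with 0 by field;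
  rewrite exp_0, ?cos_0, ?sin_0; ring.
Qed.

Lemma cexp_pexp c u w t :
  Re c = IZR w * t cz / 2 -> Im c = eps * IZR u * t cx / 6 ->
  cexp c = peval eps (pexp u w) t.
Proof.
intros HR HI. unfold pexp. rewrite peval_monomial. unfold cexp, mval. simpl.
rewrite HR, HI. apply injective_projections; simpl; ring.
Qed.

Lemma eps_sq : eps * eps = 1.
Proof. destruct Heps as [-> | ->]; ring. Qed.

Ltac expand :=
  repeat (rewrite comp_fmap || rewrite (peval_add eps) || rewrite (peval_mul eps eps_sq)).

(* The two sides agree only modulo [eps * eps = 1], which [field] does not use;
   for a fixed sign they agree identically. *)
Ltac compare :=
  unfold tadd, tscal, ddx; simpl coord_eq_dec; cbv iota;
  apply injective_projections; unfold Q2R; simpl;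
  destruct Heps as [-> | ->]; field.

Lemma peval_nil t : peval eps [] t = RtoC 0.
Proof. reflexivity. Qed.

Lemma E1_feval t k : E1 t k = (RtoC eps * feval eps sym_E1 t k)%C.
Proof.
destruct (peval_coordinates t) as (Hy & Hp & Hq).
unfold feval, E1, sym_E1; destruct k; cbn [comp fx fy fz fp fq]; expand;
  rewrite ?peval_nil, ?peval_pc, ?Hy, ?Hp, ?Hq; compare.
Qed.

Lemma E2_feval t k : E2 t k = feval eps sym_E2 t k.
Proof.
destruct (peval_coordinates t) as (Hy & Hp & Hq).
unfold feval, E2, sym_E2; destruct k; cbn [comp fx fy fz fp fq]; expand;
  rewrite ?peval_nil, ?peval_pc, ?Hy, ?Hp, ?Hq; compare.
Qed.

Lemma E3_feval t k : E3 t k = (RtoC eps * feval eps sym_E3 t k)%C.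
Proof.
destruct (peval_coordinates t) as (Hy & Hp & Hq).
unfold feval, E3, sym_E3; destruct k; cbn [comp fx fy fz fp fq]; expand;
  rewrite ?peval_nil, ?peval_pc, ?Hy, ?Hp, ?Hq; compare.
Qed.

Lemma feval_fadd V W t k : feval eps (fadd V W) t k = (feval eps V t k + feval eps W t k)%C.
Proof. unfold feval, fadd. now rewrite comp_fmap, peval_add. Qed.

Lemma feval_fscal P V t k : feval eps (fscal P V) t k = (peval eps P t * feval eps V t k)%C.
Proof. unfold feval, fscal. now rewrite comp_fmap, (peval_mul eps eps_sq). Qed.

Lemma X1_feval t k : X1 t k = feval eps sym_X1 t k.
Proof.
unfold X1, sym_X1. rewrite feval_fadd, feval_fscal. unfold tadd at 1, tscal at 1.
rewrite E2_feval, peval_pc. generalize (feval eps sym_E2 t k); intro e.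
unfold feval; destruct k; cbn [comp fx fy fz fp fq]; rewrite ?peval_nil, ?peval_pc; compare.
Qed.

Lemma X2_feval t k : X2 eps t k = (RtoC eps * feval eps sym_X2 t k)%C.
Proof.
unfold X2, sym_X2. rewrite !feval_fadd, !feval_fscal.
rewrite !(peval_mul eps eps_sq), !peval_pc.
rewrite (cexp_pexp _ 2 0 t); [|simpl; field..].
unfold tadd, tscal. rewrite E1_feval, E3_feval. unfold alpha.
generalize (feval eps sym_E1 t k) (feval eps sym_E3 t k) (peval eps (pexp 2 0) t).
intros e1 e3 e.
unfold feval; destruct k; cbn [comp fx fy fz fp fq]; rewrite ?peval_nil, ?peval_pc; compare.
Qed.

Lemma S1_feval : S1 eps = feval eps sym_S1.
Proof.
apply functional_extensionality; intro t; apply functional_extensionality; intro k.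
destruct (peval_coordinates t) as (Hy & Hp & Hq).
unfold S1, sym_S1. rewrite !feval_fadd, !feval_fscal. expand.
rewrite !peval_pc, Hy, Hp.
rewrite (cexp_pexp _ 1 (-1) t); [|simpl; field..].
rewrite (cexp_pexp _ (-1) (-1) t); [|simpl; field..].
unfold tadd, tscal. rewrite X1_feval, X2_feval.
generalize (feval eps sym_X1 t k) (feval eps sym_X2 t k)
  (peval eps (pexp 1 (-1)) t) (peval eps (pexp (-1) (-1)) t).
intros; compare.
Qed.

Lemma S2_feval : S2 eps = feval eps sym_S2.
Proof.
apply functional_extensionality; intro t; apply functional_extensionality; intro k.
destruct (peval_coordinates t) as (Hy & Hp & Hq).
unfold S2, sym_S2. rewrite !feval_fadd, !feval_fscal. expand.
rewrite !peval_pc, Hy.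
rewrite (cexp_pexp _ 1 1 t); [|simpl; field..].
rewrite (cexp_pexp _ (-1) 1 t); [|simpl; field..].
unfold tadd, tscal. rewrite X1_feval, X2_feval.
generalize (feval eps sym_X1 t k) (feval eps sym_X2 t k)
  (peval eps (pexp 1 1) t) (peval eps (pexp (-1) 1) t).
intros; compare.
Qed.

Lemma S3_feval : S3 eps = feval eps sym_S3.
Proof.
apply functional_extensionality; intro t; apply functional_extensionality; intro k.
destruct (peval_coordinates t) as (Hy & Hp & Hq).
unfold S3, sym_S3. rewrite !feval_fadd, !feval_fscal. expand.
rewrite feval_fadd, !feval_fscal.
rewrite !peval_pc, Hq.
rewrite (cexp_pexp (- RtoC eps * _) (-4) 0 t); [|simpl; field..].
rewrite (cexp_pexp _ 2 0 t); [|simpl; field..].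
unfold tadd, tscal. rewrite X1_feval, X2_feval, E1_feval, E3_feval.
generalize (feval eps sym_X1 t k) (feval eps sym_X2 t k)
  (feval eps sym_E1 t k) (feval eps sym_E3 t k)
  (peval eps (pexp 2 0) t) (peval eps (pexp (-4) 0) t).
intros; compare.
Qed.

End Fields.

(** * Structure constants of the rolling fields *)

(** The basis with [h] and [H] in place of the two normalized Cartan elements. *)
Definition iterated_brackets {T : Type} (br : T -> T -> T) (S1 S2 S3 : T) : list T :=
  let S4 := br S1 S2 in
  let S5 := br S2 S3 in
  let S6 := br S3 S1 in
  [S1; S2; S3; S4; S5; S6; br S4 S3; br S2 S6;
   br S1 S4; br S2 S4; br S2 S5; br S3 S5; br S3 S6; br S1 S6].

Lemma iterated_brackets_map {T T' : Type} (br : T -> T -> T) (br' : T' -> T' -> T') f a b c :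
  (forall u v, br' (f u) (f v) = f (br u v)) ->
  iterated_brackets br' (f a) (f b) (f c) = map f (iterated_brackets br a b c).
Proof. intros H. unfold iterated_brackets; simpl. now rewrite !H. Qed.

Definition field_basis : list fld := iterated_brackets fbracket sym_S1 sym_S2 sym_S3.

Definition fld0 : fld := fmap (fun _ => []).

Fixpoint flincomb (c : list Z) (l : list fld) : fld :=
  match c, l with
  | a :: c', V :: l' =>
      if Z.eqb a 0 then flincomb c' l'
      else fadd (fscal (pc (inject_Z a) 0) V) (flincomb c' l')
  | _, _ => fld0
  end.

Definition feq (V W : fld) : bool := fzero (fadd V (fscal (pc (-1) 0) W)).

Definition check_structure (l : list fld) : bool :=
  forallb (fun i => forallb (fun j =>
    feq (fbracket (nth i l fld0) (nth j l fld0)) (flincomb (structure_coefs i j) l))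
    (seq 0 14)) (seq 0 14).

Lemma field_basis_structure : check_structure field_basis = true.
Proof. vm_compute; reflexivity. Qed.

Section Realization.

Variable eps : R.
Hypothesis Heps : eps = 1 \/ eps = -1.

Let sq : eps * eps = 1 := eps_sq eps Heps.

Lemma feval_plus V W : feval eps (fadd V W) = plus (feval eps V) (feval eps W).
Proof.
apply functional_extensionality; intro t; apply functional_extensionality; intro k.
apply feval_fadd.
Qed.

Lemma feval_scal a V :
  feval eps (fscal (pc a 0) V) = scal (Q2R a) (feval eps V).
Proof.
apply functional_extensionality; intro t; apply functional_extensionality; intro k.
rewrite feval_fscal by assumption. rewrite peval_pc.
transitivity (RtoC (Q2R a) * feval eps V t k)%C; [|now rewrite <- C_scal].
f_equal. apply injective_projections; simpl; [easy|unfold Q2R; simpl; ring].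
Qed.

Lemma feval_fld0 : feval eps fld0 = zero.
Proof.
apply functional_extensionality; intro t; apply functional_extensionality; intro k.
unfold feval, fld0. now rewrite comp_fmap.
Qed.

Lemma fzero_correct V : fzero V = true -> feval eps V = zero.
Proof.
intros H. unfold fzero in H. rewrite forallb_forall in H.
apply functional_extensionality; intro t; apply functional_extensionality; intro k.
assert (Hk : In k [cx; cy; cz; cp; cq]) by (destruct k; simpl; auto 6).
specialize (H k Hk). rewrite forallb_forall in H.
unfold feval. change (peval eps (comp V k) t = RtoC 0).
induction (comp V k) as [|[c m] P IH]; [easy|]. simpl.
rewrite (gval_zero eps c); [|apply (H (c, m)); now left].
rewrite IH; [ring|]. intros e He; apply H; now right.
Qed.

Lemma feq_correct V W : feq V W = true -> feval eps V = feval eps W.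
Proof.
intros H. apply fzero_correct in H. rewrite feval_plus, feval_scal in H.
replace (Q2R (-1)) with (opp (@one R_Ring)) in H
  by (unfold opp, one, Q2R; simpl; field).
rewrite scal_opp_one in H. apply (plus_reg_r (opp (feval eps W))).
etransitivity; [exact H|]. symmetry. apply (plus_opp_r (feval eps W)).
Qed.

Lemma feval_flincomb c l :
  feval eps (flincomb c l) = lincomb (map IZR c) (map (feval eps) l).
Proof.
revert l; induction c as [|a c IH]; intros [|V l]; simpl; try apply feval_fld0.
destruct (Z.eqb_spec a 0) as [->|Ha].
- rewrite IH, scal_0. symmetry. apply (plus_zero_l (G := vfield)).
- rewrite feval_plus, feval_scal, IH. do 2 f_equal. unfold Q2R; simpl; field.
Qed.

Definition rolling_basis : list vfield := map (feval eps) field_basis.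

Lemma rolling_basis_eq :
  iterated_brackets lie_bracket (S1 eps) (S2 eps) (S3 eps) = rolling_basis.
Proof.
rewrite S1_feval, S2_feval, S3_feval by assumption.
apply iterated_brackets_map. intros; now apply lie_bracket_feval.
Qed.

Lemma check_structure_correct l i j :
  check_structure l = true -> (i < 14)%nat -> (j < 14)%nat ->
  let b := map (feval eps) l in
  lie_bracket (nth i b (feval eps fld0)) (nth j b (feval eps fld0))
  = lincomb (map IZR (structure_coefs i j)) b.
Proof.
intros H Hi Hj b. unfold b. rewrite !map_nth, (lie_bracket_feval eps sq), <- feval_flincomb.
apply feq_correct. unfold check_structure in H.
rewrite forallb_forall in H. specialize (H i).
rewrite forallb_forall in H. apply H; apply in_seq; lia.
Qed.

Definition sample_point (y p q : Z) : point := fun k =>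
  match k with cy => IZR y | cp => IZR p | cq => IZR q | _ => 0 end.

(** On the slice [x = z = 0] both exponentials are [1], so at integer points the
    coefficients take computable values in [Q[j]]. *)
Definition sample (y p q : Z) (P : poly) : gauss :=
  fold_right (fun e s =>
    let m := snd e in
    let r := (y ^ Z.of_nat (my m) * p ^ Z.of_nat (mp m) * q ^ Z.of_nat (mq m))%Z in
    gadd (gmul (fst e) (Gauss (inject_Z r) 0)) s) (Gauss 0 0) P.

Lemma peval_sample y p q P :
  peval eps P (sample_point y p q) = gval eps (sample y p q P).
Proof.
induction P as [|[c m] P IH].
- apply injective_projections; unfold gval, Q2R; simpl; field.
- cbn [peval sample fold_right fst snd] in *. rewrite gval_add, (gval_mul eps sq).
  unfold peval in IH; rewrite IH. do 2 f_equal.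
  unfold mval, sample_point; apply injective_projections; simpl;
  replace (IZR (mw m) * 0 / 2) with 0 by field;
  replace (eps * IZR (mu m) * 0 / 6) with 0 by field;
  rewrite exp_0, ?cos_0, ?sin_0; unfold Q2R; simpl;
  rewrite ?mult_IZR, <- ?pow_IZR; field.
Qed.

Lemma lincomb_map {U V : ModuleSpace R_Ring} (f : U -> V) c l :
  f zero = zero -> (forall a u v, f (plus (scal a u) v) = plus (scal a (f u)) (f v)) ->
  f (lincomb c l) = lincomb c (map f l).
Proof.
intros F0 Fl; revert l; induction c as [|a c IH]; intros [|u l]; simpl; auto.
now rewrite Fl, IH.
Qed.

Lemma sample_dependency c k y p q :
  lincomb c rolling_basis = zero ->
  lincomb (V := R_ModuleSpace) c
    (map Q2R (map (fun V => g1 (sample y p q (comp V k))) field_basis)) = 0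
  /\ lincomb (V := R_ModuleSpace) c
    (map Q2R (map (fun V => gj (sample y p q (comp V k))) field_basis)) = 0.
Proof.
intros H. split.
- transitivity (Re (lincomb c rolling_basis (sample_point y p q) k)); [|now rewrite H].
  rewrite (lincomb_map (V := R_ModuleSpace) (fun X : vfield => Re (X (sample_point y p q) k))).
  + unfold rolling_basis. rewrite !map_map. f_equal. apply map_ext; intro V.
    unfold feval. now rewrite peval_sample.
  + reflexivity.
  + intros a u v. do 2 (unfold plus, scal; simpl). unfold mult; simpl. reflexivity.
- transitivity (eps * Im (lincomb c rolling_basis (sample_point y p q) k));
    [|rewrite H; apply Rmult_0_r].
  rewrite (lincomb_map (V := R_ModuleSpace)
    (fun X : vfield => eps * Im (X (sample_point y p q) k))).
  + unfold rolling_basis. rewrite !map_map. f_equal. apply map_ext; intro V.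
    unfold feval. rewrite peval_sample. simpl. rewrite <- Rmult_assoc, sq. ring.
  + apply Rmult_0_r.
  + intros a u v. do 2 (unfold plus, scal; simpl). unfold mult, Im; simpl. ring.
Qed.

(* Unfolding [field_basis] runs all the iterated brackets, which is fast by
   [vm_compute] only. *)
Ltac evaluate_at D k y p q H :=
  let E1 := fresh "E" in let E2 := fresh "E" in
  destruct (D k y p q H) as [E1 E2];
  match type of E1 with lincomb _ (map _ ?l) = _ =>
    let v := eval vm_compute in l in
    replace l with v in E1 by (vm_compute; reflexivity) end;
  match type of E2 with lincomb _ (map _ ?l) = _ =>
    let v := eval vm_compute in l in
    replace l with v in E2 by (vm_compute; reflexivity) end;
  simpl in E1, E2;
  unfold plus, scal, zero in E1, E2; simpl in E1, E2; unfold mult, Q2R in E1, E2; simpl in E1, E2.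

(** Values at the origin, and of the component along [q] at the three unit points,
    give a system of linear equations with only the zero solution. *)
Lemma rolling_basis_indep : lin_indep rolling_basis.
Proof.
intros c Hc H.
assert (D := sample_dependency c).
do 14 (destruct c as [|? c]; [discriminate|]). destruct c; [|discriminate]. clear Hc.
evaluate_at D cx 0%Z 0%Z 0%Z H.
evaluate_at D cy 0%Z 0%Z 0%Z H.
evaluate_at D cz 0%Z 0%Z 0%Z H.
evaluate_at D cp 0%Z 0%Z 0%Z H.
evaluate_at D cq 0%Z 0%Z 0%Z H.
evaluate_at D cq 1%Z 0%Z 0%Z H.
evaluate_at D cq 0%Z 1%Z 0%Z H.
evaluate_at D cq 0%Z 0%Z 1%Z H.
clear D H.
repeat constructor; lra.
Qed.

End Realization.

(** * From the integral basis to the orthogonal Cartan elements *)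

Section Cartan.

Context {V : ModuleSpace R_Ring}.
Implicit Types (h k r : V).

Definition comb (a b : R) h k : V := plus (scal a h) (scal b k).

Lemma comb_add a b c d h k :
  plus (comb a b h k) (comb c d h k) = comb (a + c) (b + d) h k.
Proof.
unfold comb.
change (a + c) with (@plus R_Ring a c). change (b + d) with (@plus R_Ring b d).
rewrite !(scal_distr_r (V := V)), <- !plus_assoc. f_equal.
rewrite !plus_assoc. f_equal. apply plus_comm.
Qed.

Lemma comb_scal x a b h k : scal x (comb a b h k) = comb (x * a) (x * b) h k.
Proof. unfold comb. rewrite scal_distr_l, !scal_assoc. reflexivity. Qed.

Lemma comb_minus a h k : scal a (minus h k) = comb a (- a) h k.
Proof.
etransitivity; [exact (scal_distr_l a h (opp k))|]. unfold comb. f_equal.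
etransitivity; [exact (scal_opp_r a k)|]. symmetry. exact (scal_opp_l a k).
Qed.

Lemma comb_plus a h k : scal a (plus h k) = comb a a h k.
Proof. apply scal_distr_l. Qed.

Lemma bilinear_scal_l (br : V -> V -> V) (K : V -> Prop) a u w :
  bilinear_on br K -> K zero -> K u -> K w -> br (scal a u) w = scal a (br u w).
Proof.
intros Hb K0 Ku Kw.
rewrite <- (plus_zero_r (scal a u)), (proj1 Hb) by assumption.
rewrite (bilinear_zero_l br K) by assumption. apply plus_zero_r.
Qed.

Lemma comb_bracket (br : V -> V -> V) (K : V -> Prop) a b h k r :
  bilinear_on br K -> K zero -> (forall a u, K u -> K (scal a u)) ->
  K h -> K k -> K r ->
  br (comb a b h k) r = comb a b (br h r) (br k r).
Proof.
intros Hb K0 Ks Kh Kk Kr. unfold comb.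
rewrite (proj1 Hb), (bilinear_scal_l br K) by auto. reflexivity.
Qed.

Lemma comb_weights a b c d r : comb a b (scal c r) (scal d r) = scal (a * c + b * d) r.
Proof.
unfold comb. rewrite !scal_assoc.
change (a * c + b * d) with (@plus R_Ring (mult a c) (mult b d)).
symmetry. apply (scal_distr_r (V := V)).
Qed.

End Cartan.

Lemma smooth_zero : smooth zero.
Proof.
intros j k t. exists (RtoC 0). split; simpl; apply @is_derive_const.
Qed.

Lemma smooth_scal a V : smooth V -> smooth (scal a V).
Proof.
intros HV. rewrite <- (plus_zero_r (scal a V)).
apply smooth_lin; auto using smooth_zero.
Qed.

Section Normalized.
Context {V : ModuleSpace R_Ring}.
Variables s1 s2 s3 s4 s5 s6 h k l1 l2 l3 l4 l5 l6 : V.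
Let b := [s1; s2; s3; s4; s5; s6; h; k; l1; l2; l3; l4; l5; l6].
Let A := scal (1 / 4) (minus h k).
Let B := scal (sqrt 3 / 12) (plus h k).
Let b' := [s1; s2; s3; s4; s5; s6; A; B; l1; l2; l3; l4; l5; l6].

Lemma sqrt3 : sqrt 3 * sqrt 3 = 3.
Proof. apply sqrt_sqrt; lra. Qed.

(** The change of basis is inverted by [h = 2 A + 2 sqrt 3 B] and
    [k = - 2 A + 2 sqrt 3 B]. *)
Lemma normalized_span : span (fun v => In v b') = span (fun v => In v b).
Proof.
assert (HA : A = comb (1 / 4) (- (1 / 4)) h k) by apply comb_minus.
assert (HB : B = comb (sqrt 3 / 12) (sqrt 3 / 12) h k) by apply comb_plus.
assert (Hh : h = comb 2 (2 * sqrt 3) A B).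
{ unfold comb. rewrite HA, HB, !comb_scal, comb_add.
  replace (2 * (1 / 4) + 2 * sqrt 3 * (sqrt 3 / 12)) with 1 by (generalize sqrt3; lra).
  replace (2 * - (1 / 4) + 2 * sqrt 3 * (sqrt 3 / 12)) with 0 by (generalize sqrt3; lra).
  unfold comb. now rewrite scal_1, scal_0, plus_zero_r. }
assert (Hk : k = comb (- 2) (2 * sqrt 3) A B).
{ unfold comb. rewrite HA, HB, !comb_scal, comb_add.
  replace (-2 * (1 / 4) + 2 * sqrt 3 * (sqrt 3 / 12)) with 0 by (generalize sqrt3; lra).
  replace (-2 * - (1 / 4) + 2 * sqrt 3 * (sqrt 3 / 12)) with 1 by (generalize sqrt3; lra).
  unfold comb. now rewrite scal_1, scal_0, plus_zero_l. }
assert (Hcomb : forall x y u v (l : list V), In u l -> In v l ->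
          span (fun w => In w l) (comb x y u v)).
{ intros. apply span_plus; apply span_scal, span_single; assumption. }
apply functional_extensionality; intro u; apply propositional_extensionality.
split; apply span_span; intros v Hv.
- assert (C : A = v \/ B = v \/ In v b) by (unfold b; simpl in *; tauto).
  destruct C as [E|[E|Hb]]; [rewrite <- E, HA|rewrite <- E, HB|now apply span_single];
    apply Hcomb; simpl; auto 10.
- assert (C : h = v \/ k = v \/ In v b') by (unfold b'; simpl in *; tauto).
  destruct C as [E|[E|Hb]]; [rewrite <- E, Hh|rewrite <- E, Hk|now apply span_single];
    apply Hcomb; simpl; auto 10.
Qed.

Lemma normalized_indep : lin_indep b -> lin_indep b'.
Proof.
intros Hb c Hc E.
do 14 (destruct c as [|? c]; [discriminate|]). destruct c; [|discriminate]. clear Hc.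
assert (E' : lincomb [r; r0; r1; r2; r3; r4;
   r5 * (1 / 4) + r6 * (sqrt 3 / 12); r5 * - (1 / 4) + r6 * (sqrt 3 / 12);
   r7; r8; r9; r10; r11; r12] b = zero).
{ rewrite <- E. unfold b, b', A, B. rewrite comb_minus, comb_plus. simpl.
  do 6 f_equal. rewrite !comb_scal, !plus_assoc, comb_add. reflexivity. }
apply Hb in E'; [|reflexivity].
repeat match goal with H : List.Forall _ (_ :: _) |- _ => inversion H; clear H; subst end.
assert (Hs : 0 < sqrt 3) by (apply sqrt_lt_R0; lra).
assert (r5 = 0) by lra.
assert (r6 = 0).
{ assert (Hz : r6 * sqrt 3 = 0) by lra. destruct (Rmult_integral _ _ Hz); lra. }
repeat constructor; assumption.
Qed.

End Normalized.

(** * Roots, Cartan subalgebra and isomorphism *)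

Lemma in_combine_nth {T T' : Type} (l : list T) (l' : list T') d d' p :
  length l = length l' -> In p (combine l l') ->
  exists i, (i < length l)%nat /\ p = (nth i l d, nth i l' d').
Proof.
intros Hlen Hp. destruct (In_nth _ _ (d, d') Hp) as (i & Hi & E).
rewrite length_combine, <- Hlen, Nat.min_id in Hi.
exists i. split; [exact Hi|]. now rewrite <- E, combine_nth.
Qed.

Section Structure.

Variables s1 s2 s3 s4 s5 s6 h k l1 l2 l3 l4 l5 l6 d : vfield.
Let b := [s1; s2; s3; s4; s5; s6; h; k; l1; l2; l3; l4; l5; l6].
Hypothesis Hsmooth : forall V, In V b -> smooth V.
Hypothesis Hind : lin_indep b.
Hypothesis Hstr : forall i j, (i < 14)%nat -> (j < 14)%nat ->
  lie_bracket (nth i b d) (nth j b d) = lincomb (map IZR (structure_coefs i j)) b.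

Let A := scal (1 / 4) (minus h k).
Let B := scal (sqrt 3 / 12) (plus h k).
Let b' := [s1; s2; s3; s4; s5; s6; A; B; l1; l2; l3; l4; l5; l6].

Lemma span_smooth V : span (fun W => In W b) V -> smooth V.
Proof. apply span_least; auto using smooth_zero. intros; now apply smooth_lin. Qed.

Lemma bracket_bilinear_on_span : bilinear_on lie_bracket (span (fun W => In W b)).
Proof. exact (bilinear_on_incl _ _ _ span_smooth lie_bracket_bilinear). Qed.

Lemma graph_closed p q :
  In p (combine b oct_basis) -> In q (combine b oct_basis) ->
  graph b oct_basis (pair_bracket lie_bracket commutator p q).
Proof.
intros Hp Hq.
destruct (in_combine_nth b oct_basis d zero p eq_refl Hp) as (i & Hi & ->).
destruct (in_combine_nth b oct_basis d zero q eq_refl Hq) as (j & Hj & ->).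
apply graph_lincomb; [reflexivity|].
exists (map IZR (structure_coefs i j)). split; [reflexivity|].
unfold pair_bracket. cbn [fst snd].
rewrite Hstr, commutator_oct_basis by assumption. reflexivity.
Qed.

Lemma span_isomorphic :
  lie_isomorphic lie_bracket (span (fun V => In V b)) commutator split_g2.
Proof.
replace split_g2 with (span (fun D => In D oct_basis)).
- apply lie_isomorphic_of_graph; auto using oct_basis_indep, commutator_bilinear,
    bracket_bilinear_on_span, graph_closed.
- apply functional_extensionality; intro D; apply propositional_extensionality.
  symmetry; apply split_g2_span.
Qed.

Lemma span_subalgebra : subalgebra lie_bracket (span (fun V => In V b)).
Proof.
apply (span_subalgebra_of_graph lie_bracket commutator b oct_basis eq_refl);
auto using oct_basis_indep, commutator_bilinear,
    bracket_bilinear_on_span, graph_closed.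
Qed.

Ltac structure_constant i j :=
  let E := fresh "E" in
  assert (E := Hstr i j ltac:(lia) ltac:(lia));
  cbv [structure_coefs structure_coef structure_constants sc map seq fst snd fold_right
    Nat.eqb andb Z.opp lincomb nth b] in E;
  rewrite ?scal_0, ?plus_zero_l, ?plus_zero_r in E;
  etransitivity; [exact E|].

(** Since [A] and [B] are combinations of [h] and [H], written [k] here, the root of a
    common eigenvector is a combination of the two eigenvalues. *)
Lemma root_of_weights r x y a c :
  In r b -> lie_bracket h r = scal x r -> lie_bracket k r = scal y r ->
  a = (x - y) / 4 -> c = sqrt 3 * (x + y) / 12 -> root_vector A B r a c.
Proof.
intros Hr Hh Hk -> ->.
assert (Kh : smooth h) by (apply Hsmooth; simpl; auto 20).
assert (Kk : smooth k) by (apply Hsmooth; simpl; auto 20).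
assert (Kr : smooth r) by auto.
split; unfold A, B; rewrite ?comb_minus, ?comb_plus;
  rewrite (comb_bracket lie_bracket smooth), Hh, Hk, comb_weights;
  auto using smooth_zero, smooth_scal, lie_bracket_bilinear; f_equal; field.
Qed.

(* [x] and [y] are the eigenvalues of [h] and [k] on the basis vector number [i]. *)
Ltac root i x y :=
  apply (root_of_weights _ x y); [simpl; auto 20
  |structure_constant 6%nat i; rewrite ?scal_0; reflexivity
  |structure_constant 7%nat i; rewrite ?scal_0; reflexivity|field|field].

Lemma bracket_hk : lie_bracket h h = zero /\ lie_bracket h k = zero
  /\ lie_bracket k h = zero /\ lie_bracket k k = zero.
Proof.
repeat split; [structure_constant 6%nat 6%nat|structure_constant 6%nat 7%nat
  |structure_constant 7%nat 6%nat|structure_constant 7%nat 7%nat]; reflexivity.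
Qed.

Lemma bracket_comb x y z w : lie_bracket (comb x y h k) (comb z w h k) = zero.
Proof.
assert (Kh : smooth h) by (apply Hsmooth; simpl; auto 20).
assert (Kk : smooth k) by (apply Hsmooth; simpl; auto 20).
assert (Kc : smooth (comb z w h k)) by (apply smooth_lin; auto using smooth_scal).
destruct bracket_hk as (Hhh & Hhk & Hkh & Hkk).
assert (Hz : comb z w zero zero = @zero vfield).
{ unfold comb. rewrite !scal_zero_r. apply plus_zero_r. }
rewrite (comb_bracket lie_bracket smooth);
  auto using smooth_zero, smooth_scal, lie_bracket_bilinear.
rewrite (lie_bracket_antisym h), (lie_bracket_antisym k).
rewrite !(comb_bracket lie_bracket smooth);
  auto using smooth_zero, smooth_scal, lie_bracket_bilinear.
rewrite Hhh, Hhk, Hkh, Hkk, Hz. unfold comb.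
transitivity (plus (@zero vfield) zero); [|apply plus_zero_r].
assert (Ho : opp (@zero vfield) = zero) by exact (opp_zero (G := vfield)).
f_equal; rewrite Ho; apply scal_zero_r.
Qed.

Lemma abelian_AB V W : In V [A; B] -> In W [A; B] -> lie_bracket V W = zero.
Proof.
intros HV HW. simpl in HV, HW.
destruct HV as [<-|[<-|[]]], HW as [<-|[<-|[]]]; unfold A, B;
  rewrite ?comb_minus, ?comb_plus; apply bracket_comb.
Qed.

Lemma root_system :
  root_vector A B s1 1 0
  /\ root_vector A B s5 (-1) 0
  /\ root_vector A B s4 (1 / 2) (sqrt 3 / 2)
  /\ root_vector A B s3 (- (1 / 2)) (- (sqrt 3 / 2))
  /\ root_vector A B s2 (- (1 / 2)) (sqrt 3 / 2)
  /\ root_vector A B s6 (1 / 2) (- (sqrt 3 / 2))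
  /\ root_vector A B l1 (3 / 2) (sqrt 3 / 2)
  /\ root_vector A B l4 (- (3 / 2)) (- (sqrt 3 / 2))
  /\ root_vector A B l2 0 (sqrt 3)
  /\ root_vector A B l5 0 (- sqrt 3)
  /\ root_vector A B l3 (- (3 / 2)) (sqrt 3 / 2)
  /\ root_vector A B l6 (3 / 2) (- (sqrt 3 / 2)).
Proof.
split; [root 0%nat 2 (-2)|]. split; [root 4%nat (-2) 2|].
split; [root 3%nat 4 2|]. split; [root 2%nat (-4) (-2)|].
split; [root 1%nat 2 4|]. split; [root 5%nat (-2) (-4)|].
split; [root 8%nat 6 0|]. split; [root 11%nat (-6) 0|].
split; [root 9%nat 6 6|]. split; [root 12%nat (-6) (-6)|].
split; [root 10%nat 0 6|root 13%nat 0 (-6)].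
Qed.

Lemma cartan_AB :
  cartan_subalgebra lie_bracket (span (fun V => In V b')) (span (fun V => In V [A; B])).
Proof.
assert (Hs : span (fun V => In V b') = span (fun V => In V b)) by apply normalized_span.
apply cartan_of_weights.
- now apply normalized_indep.
- intros V HV. simpl in *; tauto.
- rewrite Hs. apply bracket_bilinear_on_span.
- apply lie_bracket_antisym.
- apply abelian_AB.
- intros t r Ht Hr.
  assert (C : In r [A; B] \/ exists a c, root_vector A B r a c).
  { destruct root_system as (R1 & R5 & R4 & R3 & R2 & R6 & Q1 & Q4 & Q2 & Q5 & Q3 & Q6).
    simpl in Hr.
    repeat (destruct Hr as [<-|Hr];
      [first [right; do 2 eexists; eassumption | left; simpl; tauto]|]).
    destruct Hr. }
  destruct C as [C|(a & c & HA & HB)].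
  + exists 0. rewrite abelian_AB by assumption. symmetry. apply scal_0.
  + destruct Ht as [<-|[<-|[]]]; eauto.
- intros r Hr.
  assert (Hs3 : 0 < sqrt 3) by (apply sqrt_lt_R0; lra).
  assert (C : In r [A; B] \/ exists a c, root_vector A B r a c /\ (a <> 0 \/ c <> 0)).
  { destruct root_system as (R1 & R5 & R4 & R3 & R2 & R6 & Q1 & Q4 & Q2 & Q5 & Q3 & Q6).
    simpl in Hr.
    repeat (destruct Hr as [<-|Hr];
      [first [left; simpl; tauto
             |right; do 2 eexists; split; [eassumption|];
              first [left; intro; lra | right; intro; lra]]|]).
    destruct Hr. }
  destruct C as [C|(a & c & [HA HB] & [Ha|Hc])]; [now left|right..].
  + exists A, a. simpl; auto.
  + exists B, c. simpl; auto.
Qed.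

End Structure.

Theorem theorem4p1 (eps : R) (Heps : eps = 1 \/ eps = -1) :
  pairwise_bracket_generate_split_g2 (S1 eps) (S2 eps) (S3 eps).
Proof.
assert (Hind := rolling_basis_indep eps Heps).
assert (Hstr := fun i j =>
  check_structure_correct eps Heps field_basis i j field_basis_structure).
cbv zeta in Hstr. fold (rolling_basis eps) in Hstr.
assert (Hsm : forall V, In V (rolling_basis eps) -> smooth V).
{ intros V HV. apply in_map_iff in HV. destruct HV as (W & <- & _).
  apply smooth_feval. now apply eps_sq. }
rewrite <- rolling_basis_eq in Hind, Hstr, Hsm by assumption.
unfold iterated_brackets in Hind, Hstr, Hsm. cbv zeta in Hind, Hstr, Hsm.
unfold pairwise_bracket_generate_split_g2; cbv zeta.
split; [|split; [|split; [|split]]].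
- now apply normalized_indep.
- rewrite normalized_span.
  now apply (span_subalgebra _ _ _ _ _ _ _ _ _ _ _ _ _ _ (feval eps fld0)).
- rewrite normalized_span.
  now apply (span_isomorphic _ _ _ _ _ _ _ _ _ _ _ _ _ _ (feval eps fld0)).
- now apply (cartan_AB _ _ _ _ _ _ _ _ _ _ _ _ _ _ (feval eps fld0)).
- now apply (root_system _ _ _ _ _ _ _ _ _ _ _ _ _ _ (feval eps fld0)).
Qed.
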